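(* Let $A$ be a Hopf $\ast$-algebra, $B$ a left $A$-comodule $\ast$-algebra, and $(\Omega^\bullet,\wedge,d)$ an $A$-covariant $\ast$-differential calculus on $B$ such that $\Omega^1$ is finitely generated and projective as a left $B$-module. Then there is a one to one correspondence between real $A$-covariant metrics on $\Omega^1$ and $A$-covariant Hermitian metrics on $\Omega^1$.
   Context: All algebras are unital over $\mathbb{C}$; left coactions are written $m\mapsto m_{(-1)}\otimes m_{(0)}$; $S$ is the antipode of $A$. ${}^{A}_{B}\mathcal{M}_B$ is the category of $B$-bimodules $M$ with a left $A$-coaction satisfying $\delta(bmc)=\delta(b)\delta(m)\delta(c)$; morphisms are $B$-bilinear, left $A$-colinear maps. A differential calculus over $B$ is a differential graded algebra $(\Omega^\bullet,\wedge,d)$ with $\Omega^0=B$, generated by $B$ and $dB$; a $\ast$-calculus has a degree-preserving conjugate-linear involution extending $\ast$ on $B$ with $(d\omega)^*=d(\omega^* )$, $(\omega\wedge\nu)^*=(-1)^{kl}\nu^*\wedge\omega^*$ for $\omega\in\Omega^k$, $\nu\in\Omega^l$; it is $A$-covariant if the coaction of $B$ extends to a comodule $\ast$-algebra coaction on $\Omega^\bullet$ with every $\Omega^k\in{}^{A}_{B}\mathcal{M}_B$ and $d$ colinear. For a $B$-bimodule $M$, $\overline{M}=\{\overline m:m\in M\}$ is the conjugate vector space with $b\cdot\overline m=\overline{m b^*}$, $\overline m\cdot b=\overline{b^*m}$, and coaction $\overline m\mapsto m_{(-1)}^*\otimes\overline{m_{(0)}}$ if $M$ is a left $A$-comodule.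 ${}_B\mathrm{Hom}(M,B)$ (left $B$-linear maps) is a $B$-bimodule via $(bf)(m)=f(mb)$, $(fb)(m)=f(m)b$; if $M\in{}^{A}_{B}\mathcal{M}_B$ is finitely generated projective as a left $B$-module, it carries the coaction determined by $f_{(-1)}\otimes f_{(0)}(m)=S(m_{(-1)})[f(m_{(0)})]_{(-1)}\otimes[f(m_{(0)})]_{(0)}$. A (nondegenerate) Hermitian metric on a $B$-bimodule $\mathcal{E}$ is a $B$-bimodule isomorphism $\mathscr{H}:\overline{\mathcal{E}}\to{}_B\mathrm{Hom}(\mathcal{E},B)$ such that $\langle f,\overline e\rangle^*=\langle e,\overline f\rangle$ for all $e,f\in\mathcal{E}$, where $\langle e,\overline f\rangle:=\mathscr{H}(\overline f)(e)$. It is $A$-covariant if $\mathscr{H}$ is left $A$-colinear. A metric on $\Omega^1$ is a pair $(g,(\ ,\ ))$ with $g\in\Omega^1\otimes_B\Omega^1$ and $(\ ,\ ):\Omega^1\otimes_B\Omega^1\to B$ $B$-bilinear such that $((\omega,\ )\otimes_B\mathrm{id})g=\omega=(\mathrm{id}\otimes_B(\ ,\omega))g$ for all $\omega\in\Omega^1$. It is $A$-covariant if $(\ ,\ )$ and $b\mapsto bg$ are left $A$-colinear, and real if $g^\dagger=g$, where $(\omega\otimes_B\eta)^\dagger=\eta^*\otimes_B\omega^*$ (antilinear). *)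

(* Defs.v *)
From HB Require Import structures.
From mathcomp Require Import all_boot all_order all_algebra.
From mathcomp Require Import generic_quotient.
From mathcomp Require Import boolp classical_sets functions.
From mathcomp Require Import reals complex.

Set Implicit Arguments.
Unset Strict Implicit.
Unset Printing Implicit Defensive.

Import GRing.Theory Num.Theory.
Local Open Scope ring_scope.
Local Open Scope quotient_scope.

(******************************************************************************)
(* Tensor products by generators and relations.                               *)
(* [tens ra la] is the quotient of formal sums of pairs (m, n) (sequences) by *)
(* the C-linear relations making (m, n) biadditive and [K]-balanced:          *)
(* (ra m k, n) ~ (m, la k n). Scalars of C act on the left factor.            *)
(* It is used with K = C (tensor product over C) and with K a C-algebra B     *)
(* (tensor product over B of a right and a left B-module).                    *)
(******************************************************************************)
Section Tensor.
Variables (C : pzRingType) (M N : lmodType C) (K : Type).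
Variables (ra : M -> K -> M) (la : K -> N -> N).

Definition fscale (c : C) (s : seq (M * N)) : seq (M * N) :=
  [seq (c *: p.1, p.2) | p <- s].

Inductive tens_rel : seq (M * N) -> seq (M * N) -> Prop :=
| tens_refl s : tens_rel s s
| tens_sym s t : tens_rel s t -> tens_rel t s
| tens_trans s t u : tens_rel s t -> tens_rel t u -> tens_rel s u
| tens_cat s s' t t' :
    tens_rel s s' -> tens_rel t t' -> tens_rel (s ++ t) (s' ++ t')
| tens_comm s t : tens_rel (s ++ t) (t ++ s)
| tens_scale c s t : tens_rel s t -> tens_rel (fscale c s) (fscale c t)
| tens_0l n : tens_rel [:: (0, n)] [::]
| tens_Dl m m' n : tens_rel [:: (m + m', n)] [:: (m, n); (m', n)]
| tens_Dr m n n' : tens_rel [:: (m, n + n')] [:: (m, n); (m, n')]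
| tens_bal m k n : tens_rel [:: (ra m k, n)] [:: (m, la k n)].

Definition tens_eqv (s t : seq (M * N)) : bool := `[< tens_rel s t >].

Lemma tens_eqv_refl : reflexive tens_eqv.
Proof. by move=> s; apply/asboolP; exact: tens_refl. Qed.

Lemma tens_eqv_sym : symmetric tens_eqv.
Proof. by move=> s t; apply/asboolP/asboolP => /tens_sym. Qed.

Lemma tens_eqv_trans : transitive tens_eqv.
Proof.
by move=> t s u /asboolP st /asboolP tu; apply/asboolP; exact: tens_trans tu.
Qed.

Canonical tens_equiv :=
  EquivRel tens_eqv tens_eqv_refl tens_eqv_sym tens_eqv_trans.

Definition tens := {eq_quot tens_equiv}.
HB.instance Definition _ := EqQuotient.on tens.
HB.instance Definition _ := Choice.on tens.

Lemma tens_piP (s t : seq (M * N)) :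
  tens_rel s t <-> \pi_tens s = \pi_tens t.
Proof.
split=> [st|/eqmodP/asboolP //]; apply/eqmodP; exact/asboolP.
Qed.

Lemma tens_repr (s : seq (M * N)) : tens_rel (repr (\pi_tens s)) s.
Proof. by apply/tens_piP; rewrite reprK. Qed.

Definition tzero : tens := \pi_tens [::].
Definition tadd (x y : tens) : tens := \pi_tens (repr x ++ repr y).
Definition tscale (c : C) (x : tens) : tens := \pi_tens (fscale c (repr x)).
Definition topp (x : tens) : tens := tscale (-1) x.

Lemma tadd_pi s t : tadd (\pi_tens s) (\pi_tens t) = \pi_tens (s ++ t).
Proof. by apply/tens_piP; apply: tens_cat; apply: tens_repr. Qed.

Lemma tscale_pi c s : tscale c (\pi_tens s) = \pi_tens (fscale c s).
Proof. by apply/tens_piP; apply: tens_scale; apply: tens_repr. Qed.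

Lemma taddA : associative tadd.
Proof.
move=> x y z; elim/quotW: x => s; elim/quotW: y => t; elim/quotW: z => u.
by rewrite (tadd_pi t u) (tadd_pi s t) (tadd_pi s) (tadd_pi (s ++ t)) catA.
Qed.

Lemma taddC : commutative tadd.
Proof.
by move=> x y; apply/tens_piP; exact: tens_comm.
Qed.

Lemma tadd0 : left_id tzero tadd.
Proof. by elim/quotW=> s; rewrite /tzero tadd_pi. Qed.

Lemma tens_rel_Dl c c' s :
  tens_rel (fscale (c + c') s) (fscale c s ++ fscale c' s).
Proof.
elim: s => [|[m n] s IH]; first exact: tens_refl.
set S := fscale c s in IH *; set S' := fscale c' s in IH *.
have /= := tens_cat (tens_Dl (c *: m) (c' *: m) n) IH.
rewrite -scalerDl => /tens_trans; apply.
rewrite -/S -/S'.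
have -> : (c *: m, n) :: S ++ (c' *: m, n) :: S' =
    [:: (c *: m, n)] ++ ((S ++ [:: (c' *: m, n)]) ++ S') by rewrite -catA.
apply: (tens_cat (s := [:: _])); first exact: tens_refl.
apply: (tens_cat (s := [:: (c' *: m, n)] ++ S) (t := S')); last exact: tens_refl.
exact: tens_comm.
Qed.

Lemma tscale0 x : tscale 0 x = tzero.
Proof.
apply/tens_piP; elim: (repr x) => [|[m n] s IH] /=; first exact: tens_refl.
rewrite scale0r; apply: (@tens_cat [:: _] [::] _ _ _ IH); exact: tens_0l.
Qed.

Lemma tscale1 : left_id 1 tscale.
Proof.
move=> x; rewrite -[RHS]reprK /tscale; congr (\pi_tens _).
by elim: (repr x) => //= -[m n] s ->; rewrite scale1r.
Qed.

Lemma tscaleDl x : {morph tscale^~ x : c c' / c + c' >-> tadd c c'}.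
Proof.
elim/quotW: x => s c c'; rewrite !(tscale_pi _ s) (tadd_pi (fscale c s)).
by apply/tens_piP; exact: tens_rel_Dl.
Qed.

Lemma taddN : left_inverse tzero topp tadd.
Proof.
move=> x; rewrite /topp -{2}[x]tscale1 -tscaleDl addNr; exact: tscale0.
Qed.

HB.instance Definition _ := GRing.isZmodule.Build tens taddA taddC tadd0 taddN.

Lemma tscaleA c c' x : tscale c (tscale c' x) = tscale (c * c') x.
Proof.
elim/quotW: x => s.
rewrite (tscale_pi c' s) (tscale_pi c) (tscale_pi _ s); congr (\pi_tens _).
by elim: s => //= -[m n] s ->; rewrite scalerA.
Qed.

Lemma tscaleDr : right_distributive tscale +%R.
Proof.
move=> c; elim/quotW=> s; elim/quotW=> t.
have addE (u v : tens) : u + v = tadd u v by [].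
rewrite !addE (tadd_pi s t) (tscale_pi c s) (tscale_pi c t) (tscale_pi c (s ++ t)).
by rewrite (tadd_pi (fscale c s)) /fscale map_cat.
Qed.

HB.instance Definition _ :=
  GRing.Zmodule_isLmodule.Build C tens tscaleA tscale1 tscaleDr tscaleDl.

Definition pure (m : M) (n : N) : tens := \pi_tens [:: (m, n)].

Lemma pureDl n : {morph pure^~ n : m m' / m + m'}.
Proof.
move=> m m'; rewrite -[RHS]/(tadd _ _) tadd_pi.
by apply/tens_piP; exact: tens_Dl.
Qed.

Lemma pureDr m : {morph pure m : n n' / n + n'}.
Proof.
move=> n n'; rewrite -[RHS]/(tadd _ _) tadd_pi.
by apply/tens_piP; exact: tens_Dr.
Qed.

Lemma pureZl c m n : pure (c *: m) n = c *: pure m n.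
Proof. by rewrite -[RHS]/(tscale _ _) tscale_pi. Qed.

Lemma pure_bal m k n : pure (ra m k) n = pure m (la k n).
Proof. by apply/tens_piP; exact: tens_bal. Qed.

Lemma tens_sum (x : tens) : x = \sum_(p <- repr x) pure p.1 p.2.
Proof.
rewrite -[LHS]reprK; elim: (repr x) => [|[m n] s IH]; first by rewrite big_nil.
by rewrite big_cons -IH -[RHS]/(tadd _ _) tadd_pi.
Qed.

Lemma tens_ind (P : tens -> Prop) :
  P 0 -> (forall x y, P x -> P y -> P (x + y)) ->
  (forall m n, P (pure m n)) -> forall x, P x.
Proof.
move=> P0 PD Pp x; rewrite [x]tens_sum; exact: (big_ind P).
Qed.

(* The map m (x) n |-> f m n. It is well defined when f is biadditive and     *)
(* balanced, see [tlift_pure] and [tliftD]; otherwise it depends on the       *)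
(* representative.                                                            *)
Definition tlift (V : zmodType) (f : M -> N -> V) (x : tens) : V :=
  \sum_(p <- repr x) f p.1 p.2.

Definition balanced (V : zmodType) (f : M -> N -> V) : Prop :=
  [/\ forall n, {morph f^~ n : m m' / m + m'},
      forall m, {morph f m : n n' / n + n'} &
      forall m k n, f (ra m k) n = f m (la k n)].

Section Universal.
Hypothesis raZ : forall c m k, ra (c *: m) k = c *: ra m k.
Variables (V : zmodType) (f : M -> N -> V).
Hypothesis bal_f : balanced f.

Let f0l n : f 0 n = 0.
Proof.
by case: bal_f => fDl _ _; apply: (addrI (f 0 n)); rewrite -fDl !addr0.
Qed.

Let tlift_rel s t : tens_rel s t -> forall c,
  \sum_(p <- fscale c s) f p.1 p.2 = \sum_(p <- fscale c t) f p.1 p.2.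
Proof.
have [fDl fDr fb] := bal_f.
elim=> {s t} //=.
- by move=> s t u _ IH1 _ IH2 c; rewrite IH1.
- by move=> s s' t t' _ IH1 _ IH2 c; rewrite /fscale !map_cat !big_cat /= IH1 IH2.
- by move=> s t c; rewrite /fscale !map_cat !big_cat /= addrC.
- move=> c s t _ IH c'; move: (IH (c' * c)).
  by rewrite !big_map; under eq_bigr do rewrite -scalerA;
     under [RHS]eq_bigr do rewrite -scalerA.
- by move=> n c; rewrite big_seq1 big_nil /= scaler0.
- by move=> m m' n c; rewrite !big_cons !big_nil /= scalerDr fDl !addr0.
- by move=> m n n' c; rewrite !big_cons !big_nil /= fDr !addr0.
- by move=> m k n c; rewrite !big_seq1 /= -raZ fb.
Qed.

Lemma tlift_pi s : tlift f (\pi_tens s) = \sum_(p <- s) f p.1 p.2.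
Proof.
have /(tlift_rel) /(_ 1) := tens_repr s; rewrite /tlift /fscale !big_map.
by under eq_bigr do rewrite scale1r; under [RHS]eq_bigr do rewrite scale1r.
Qed.

Lemma tlift_pure m n : tlift f (pure m n) = f m n.
Proof. by rewrite tlift_pi big_seq1. Qed.

Lemma tliftD : {morph tlift f : x y / x + y}.
Proof.
elim/quotW=> s; elim/quotW=> t.
by rewrite -[X in tlift f X]/(tadd _ _) tadd_pi !tlift_pi big_cat.
Qed.

End Universal.

End Tensor.

Section ComplexTensor.
Variable C : comPzRingType.

Definition ctens (M N : lmodType C) : lmodType C :=
  tens (fun (m : M) (c : C) => c *: m) (fun (c : C) (n : N) => c *: n).

Definition cpure (M N : lmodType C) (m : M) (n : N) : ctens M N := pure _ _ m n.

End ComplexTensor.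

Arguments ctens {C} (M N)%_type_scope.
Notation "M ⊗ N" := (ctens M N) (at level 40, left associativity) : type_scope.
Notation "m ⊗ n" := (cpure m n) (at level 40, left associativity) : ring_scope.

Section ComplexTensorMaps.
Variable C : comPzRingType.
Implicit Types M N P : lmodType C.

(* f and g have to be both linear or both conjugate-linear *)
Definition tmap M N M' N' (f : M -> M') (g : N -> N') : M ⊗ N -> M' ⊗ N' :=
  tlift (fun m n => f m ⊗ g n).

Definition tassoc M N P : (M ⊗ N) ⊗ P -> M ⊗ (N ⊗ P) :=
  tlift (fun t p => tlift (fun m n => m ⊗ (n ⊗ p)) t).

(* (a (x) m, a' (x) n) |-> a a' (x) mu m n *)
Definition tmul (A : algType C) M N P (mu : M -> N -> P)
    (x : A ⊗ M) (y : A ⊗ N) : A ⊗ P :=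
  tlift (fun a m => tlift (fun a' n => (a * a') ⊗ mu m n) y) x.

End ComplexTensorMaps.

Section StarAlgebras.
Variable C : numClosedFieldType.

Definition conjugate_linear (V W : lmodType C) (f : V -> W) : Prop :=
  forall (c : C) (u v : V), f (c *: u + v) = c^* *: f u + f v.

Record starAlgebra := StarAlgebra {
  sa_alg :> algType C;
  star : sa_alg -> sa_alg;
  star_conj : conjugate_linear star;
  starK : involutive star;
  starM : forall a b, star (a * b) = star b * star a
}.

(* S(S(a^* )^* ) = a and the antimultiplicativity of the antipode follow.     *)
Record hopfStarAlgebra := HopfStarAlgebra {
  hs_alg :> starAlgebra;
  comul : {linear hs_alg -> (hs_alg ⊗ hs_alg)%type};
  counit : {linear hs_alg -> C^o};
  antipode : {linear hs_alg -> hs_alg};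
  comulA : forall a,
    tassoc (tmap comul id (comul a)) = tmap id comul (comul a);
  counitl : forall a, tlift (fun x y => (counit x : C) *: y) (comul a) = a;
  counitr : forall a, tlift (fun x y => (counit y : C) *: x) (comul a) = a;
  comul1 : comul 1 = 1 ⊗ 1;
  comulM : forall a b, comul (a * b) = tmul *%R (comul a) (comul b);
  counit1 : counit 1 = 1;
  counitM : forall a b, counit (a * b) = counit a * counit b;
  antipodel : forall a,
    tlift (fun x y => antipode x * y) (comul a) = (counit a : C)%:A;
  antipoder : forall a,
    tlift (fun x y => x * antipode y) (comul a) = (counit a : C)%:A;
  comul_star : forall a,
    comul (star a) = tmap (@star hs_alg) (@star hs_alg) (comul a);
  counit_star : forall a, counit (star a) = (counit a : C)^*
}.

Definition is_coaction (A : hopfStarAlgebra) (V : lmodType C)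
    (delta : {linear V -> (A ⊗ V)%type}) : Prop :=
  (forall v, tmap id delta (delta v) = tassoc (tmap (comul A) id (delta v)))
  /\ (forall v, tlift (fun (a : A) (w : V) => (counit A a : C) *: w) (delta v) = v).

Record comoduleStarAlgebra (A : hopfStarAlgebra) := ComoduleStarAlgebra {
  cs_alg :> starAlgebra;
  acoact : {linear cs_alg -> (A ⊗ cs_alg)%type};
  acoactP : is_coaction acoact;
  acoact1 : acoact 1 = 1 ⊗ 1;
  acoactM : forall b c, acoact (b * c) = tmul *%R (acoact b) (acoact c);
  acoact_star : forall b,
    acoact (star b) = tmap (@star A) (@star cs_alg) (acoact b)
}.

End StarAlgebras.

Section Bimodules.
Variables (C : comPzRingType) (B : algType C).

Record bimodule := Bimodule {
  bm_sort :> lmodType C;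
  lact : B -> bm_sort -> bm_sort;
  ract : bm_sort -> B -> bm_sort;
  lact1 : forall m, lact 1 m = m;
  lactM : forall b c m, lact (b * c) m = lact b (lact c m);
  lactl : forall m (k : C) b c,
    lact (k *: b + c) m = k *: lact b m + lact c m;
  lactr : forall b (k : C) m n,
    lact b (k *: m + n) = k *: lact b m + lact b n;
  ract1 : forall m, ract m 1 = m;
  ractM : forall m b c, ract m (b * c) = ract (ract m b) c;
  ractr : forall m (k : C) b c,
    ract m (k *: b + c) = k *: ract m b + ract m c;
  ractl : forall b (k : C) m n,
    ract (k *: m + n) b = k *: ract m b + ract n b;
  lractA : forall b m c, ract (lact b m) c = lact b (ract m c)
}.

Section BimoduleLemmas.
Variable M : bimodule.
Implicit Types (m n : M) (b c : B).

Lemma lactDr b : {morph @lact M b : m n / m + n}.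
Proof. by move=> m n; rewrite -[m]scale1r lactr !scale1r. Qed.

Lemma lactDl m : {morph @lact M ^~ m : b c / b + c}.
Proof. by move=> b c; rewrite -[b]scale1r lactl !scale1r. Qed.

Lemma ractDr m : {morph @ract M m : b c / b + c}.
Proof. by move=> b c; rewrite -[b]scale1r ractr !scale1r. Qed.

Lemma ractDl b : {morph @ract M ^~ b : m n / m + n}.
Proof. by move=> m n; rewrite -[m]scale1r ractl !scale1r. Qed.

Lemma lact0r b : lact b 0 = 0 :> M.
Proof. by apply: (addrI (lact b 0)); rewrite -lactDr !addr0. Qed.

Lemma lact0l m : lact 0 m = 0.
Proof. by apply: (addrI (lact 0 m)); rewrite -lactDl !addr0. Qed.

Lemma ract0r m : ract m 0 = 0.
Proof. by apply: (addrI (ract m 0)); rewrite -ractDr !addr0. Qed.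

Lemma ract0l b : ract 0 b = 0 :> M.
Proof. by apply: (addrI (ract 0 b)); rewrite -ractDl !addr0. Qed.

Lemma lactZr b (k : C) m : lact b (k *: m) = k *: lact b m.
Proof. by rewrite -[k *: m]addr0 lactr lact0r addr0. Qed.

Lemma lactZl (k : C) b m : lact (k *: b) m = k *: lact b m.
Proof. by rewrite -[k *: b]addr0 lactl lact0l addr0. Qed.

Lemma ractZl b (k : C) m : ract (k *: m) b = k *: ract m b.
Proof. by rewrite -[k *: m]addr0 ractl ract0l addr0. Qed.

Lemma ractZr m (k : C) b : ract m (k *: b) = k *: ract m b.
Proof. by rewrite -[k *: b]addr0 ractr ract0r addr0. Qed.

End BimoduleLemmas.

Definition is_bimod_hom (M N : bimodule) (f : M -> N) : Prop :=
  [/\ {morph f : m n / m + n},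
      forall b m, f (lact b m) = lact b (f m) &
      forall m b, f (ract m b) = ract (f m) b].

Definition is_left_linear (M : bimodule) (N : lmodType B) (f : M -> N) : Prop :=
  {morph f : m n / m + n} /\ forall b m, f (lact b m) = b *: f m.

Definition left_fin_gen (M : bimodule) : Prop :=
  exists (n : nat) (e : 'I_n -> M),
    forall m, exists b : 'I_n -> B, m = \sum_(i < n) lact (b i) (e i).

Definition left_projective (M : bimodule) : Prop :=
  forall (N N' : lmodType B) (p : {linear N -> N'}) (f : M -> N'),
    (forall y, exists x, p x = y) -> is_left_linear f ->
    exists2 h : M -> N, is_left_linear h & forall m, p (h m) = f m.

Definition regular_bimod : bimodule.
Proof.
refine (@Bimodule B *%R *%R _ _ _ _ _ _ _ _ _).
- exact: mul1r.
- by move=> b c m; rewrite mulrA.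
- by move=> m k b c; rewrite mulrDl scalerAl.
- by move=> b k m n; rewrite mulrDr scalerAr.
- exact: mulr1.
- by move=> m b c; rewrite mulrA.
- by move=> m k b c; rewrite mulrDr scalerAr.
- by move=> b k m n; rewrite mulrDl scalerAl.
- by move=> b m c; rewrite mulrA.
Defined.

Section TensorB.
Variables M N : bimodule.

Definition btens : lmodType C := tens (@ract M) (@lact N).
Definition bpure (m : M) (n : N) : btens := pure _ _ m n.

Definition btens_lact (b : B) : btens -> btens :=
  tlift (fun m n => bpure (lact b m) n).
Definition btens_ract (t : btens) (b : B) : btens :=
  tlift (fun m n => bpure m (ract n b)) t.

Lemma bt_balanced_l b : balanced (@ract M) (@lact N) (fun m n => bpure (lact b m) n).
Proof.
split=> [n m m'|m n n'|m c n].
- by rewrite lactDr; exact: pureDl.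
- exact: pureDr.
- by rewrite -lractA; exact: pure_bal.
Qed.

Lemma bt_balanced_r b : balanced (@ract M) (@lact N) (fun m n => bpure m (ract n b)).
Proof.
split=> [n m m'|m n n'|m c n].
- exact: pureDl.
- by rewrite ractDl; exact: pureDr.
- by rewrite lractA; exact: pure_bal.
Qed.

Let raZ c (m : M) (b : B) : ract (c *: m) b = c *: ract m b := ractZl b c m.

Lemma btens_lact_pure b m n : btens_lact b (bpure m n) = bpure (lact b m) n.
Proof. exact: (tlift_pure raZ (bt_balanced_l b)). Qed.

Lemma btens_ract_pure b m n : btens_ract (bpure m n) b = bpure m (ract n b).
Proof. exact: (tlift_pure raZ (bt_balanced_r b)). Qed.

Lemma btens_lactD b : {morph btens_lact b : x y / x + y}.
Proof. exact: (tliftD raZ (bt_balanced_l b)). Qed.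

Lemma btens_ractD b : {morph btens_ract^~ b : x y / x + y}.
Proof. exact: (tliftD raZ (bt_balanced_r b)). Qed.

Lemma btens_lact0 b : btens_lact b 0 = 0.
Proof. by apply: (addrI (btens_lact b 0)); rewrite -btens_lactD !addr0. Qed.

Lemma btens_ract0 b : btens_ract 0 b = 0.
Proof. by apply: (addrI (btens_ract 0 b)); rewrite -btens_ractD !addr0. Qed.

Lemma bpureZr (k : C) m n : bpure m (k *: n) = k *: bpure m n.
Proof.
rewrite -{1}[n]lact1 -lactZl -[LHS](pure_bal (@ract M) (@lact N)).
by rewrite ractZr ract1; exact: pureZl.
Qed.

Definition btens_bimod : bimodule.
Proof.
refine (@Bimodule btens btens_lact btens_ract _ _ _ _ _ _ _ _ _).
- by apply: tens_ind => [|x y ex ey|m n];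
    rewrite ?btens_lact0 ?btens_lactD ?ex ?ey // btens_lact_pure lact1.
- move=> b c; apply: tens_ind => [|x y ex ey|m n].
  + by rewrite !btens_lact0.
  + by rewrite !btens_lactD ex ey.
  + by rewrite !btens_lact_pure lactM.
- move=> t k b c; elim/tens_ind: t => [|x y ex ey|m n].
  + by rewrite !btens_lact0 scaler0 addr0.
  + by rewrite !btens_lactD ex ey scalerDr addrACA.
  + by rewrite !btens_lact_pure lactl [LHS]pureDl [X in X + _]pureZl.
- move=> b k x y; rewrite btens_lactD; congr (_ + _).
  elim/tens_ind: x => [|x x' ex ex'|m n].
  + by rewrite scaler0 !btens_lact0 scaler0.
  + by rewrite scalerDr !btens_lactD ex ex' scalerDr.
  + by rewrite -[_ *: _]pureZl !btens_lact_pure lactZr [LHS]pureZl.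
- by apply: tens_ind => [|x y ex ey|m n];
    rewrite ?btens_ract0 ?btens_ractD ?ex ?ey // btens_ract_pure ract1.
- move=> t b c; elim/tens_ind: t => [|x y ex ey|m n].
  + by rewrite !btens_ract0.
  + by rewrite !btens_ractD ex ey.
  + by rewrite !btens_ract_pure ractM.
- move=> t k b c; elim/tens_ind: t => [|x y ex ey|m n].
  + by rewrite !btens_ract0 scaler0 addr0.
  + by rewrite !btens_ractD ex ey scalerDr addrACA.
  + by rewrite !btens_ract_pure ractr [LHS]pureDr -bpureZr.
- move=> b k x y; rewrite btens_ractD; congr (_ + _).
  elim/tens_ind: x => [|x x' ex ex'|m n].
  + by rewrite scaler0 !btens_ract0 scaler0.
  + by rewrite scalerDr !btens_ractD ex ex' scalerDr.
  + by rewrite -[_ *: _]pureZl !btens_ract_pure [LHS]pureZl.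
- move=> b t c; elim/tens_ind: t => [|x y ex ey|m n].
  + by rewrite !(btens_lact0, btens_ract0).
  + by rewrite !(btens_lactD, btens_ractD) ex ey.
  + by rewrite !(btens_lact_pure, btens_ract_pure).
Defined.

End TensorB.

Section LeftDual.
Variable M : bimodule.

Definition left_linear_pred : {pred M -> B} :=
  fun f => `[< is_left_linear (N := B^o) f >].

Lemma left_linear_submod : submod_closed left_linear_pred.
Proof.
split=> [|k f g /asboolP[fD fZ] /asboolP[gD gZ]]; apply/asboolP; split.
- by move=> m n /=; rewrite addr0.
- by move=> b m; rewrite scaler0.
- by move=> m n; rewrite !fctE fD gD scalerDr addrACA.
- by move=> b m; rewrite !fctE fZ gZ scalerDr; congr (_ + _); exact: scalerAr.
Qed.

HB.instance Definition _ :=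
  GRing.isSubmodClosed.Build C (M -> B) left_linear_pred left_linear_submod.

Record left_dual := LeftDual {
  dual_fun :> M -> B;
  dual_funP : dual_fun \in left_linear_pred
}.

HB.instance Definition _ := [isSub for dual_fun].
HB.instance Definition _ := [Choice of left_dual by <:].
HB.instance Definition _ := [SubChoice_isSubLmodule of left_dual by <:].

Lemma dualP (f : left_dual) : is_left_linear (N := B^o) f.
Proof. exact/asboolP/dual_funP. Qed.

Lemma dual_ext (f g : left_dual) : f =1 g -> f = g.
Proof. by move=> fg; apply: val_inj; apply/funext. Qed.

Lemma dual_lact_subproof (b : B) (f : left_dual) :
  (fun m => f (ract m b)) \in left_linear_pred.
Proof.
apply/asboolP; have [fD fZ] := dualP f.
by split=> [m n|c m]; rewrite ?ractDl ?fD // lractA fZ.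
Qed.

Lemma dual_ract_subproof (f : left_dual) (b : B) :
  (fun m => f m * b) \in left_linear_pred.
Proof.
apply/asboolP; have [fD fZ] := dualP f.
by split=> [m n|c m]; rewrite ?fD ?mulrDl // fZ -[LHS]mulrA.
Qed.

Definition dual_lact b f := LeftDual (dual_lact_subproof b f).
Definition dual_ract f b := LeftDual (dual_ract_subproof f b).

Lemma dualZ (f : left_dual) (k : C) m : f (k *: m) = k *: f m.
Proof.
have [_ fZ] := dualP f.
by rewrite -{1}[m]lact1 -lactZl fZ -[LHS]scalerAl; congr (_ *: _); exact: mul1r.
Qed.

Definition dual_bimod : bimodule.
Proof.
refine (@Bimodule left_dual dual_lact dual_ract _ _ _ _ _ _ _ _ _).
- by move=> f; apply: dual_ext => m /=; rewrite ract1.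
- by move=> b c f; apply: dual_ext => m /=; rewrite ractM.
- move=> f k b c; apply: dual_ext => m /=.
  by rewrite ractr (dualP f).1 dualZ.
- by move=> b k f g; apply: dual_ext.
- by move=> f; apply: dual_ext => m /=; rewrite mulr1.
- by move=> f b c; apply: dual_ext => m /=; rewrite mulrA.
- move=> f k b c; apply: dual_ext => m /=.
  by rewrite mulrDr -scalerAr.
- move=> b k f g; apply: dual_ext => m /=.
  by rewrite mulrDl -scalerAl.
- by move=> b f c; apply: dual_ext.
Defined.

End LeftDual.

End Bimodules.

Section Conjugate.
Variable C : numClosedFieldType.

Definition conj_space (V : lmodType C) : Type := V.
Definition cj (V : lmodType C) (v : V) : conj_space V := v.
Definition uncj (V : lmodType C) (v : conj_space V) : V := v.

Section Space.
Variable V : lmodType C.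

HB.instance Definition _ := GRing.Zmodule.copy (conj_space V) V.

Definition conj_scale (k : C) (v : conj_space V) : conj_space V :=
  cj (k^* *: uncj v).

Fact conj_scaleA k l v : conj_scale k (conj_scale l v) = conj_scale (k * l) v.
Proof. by rewrite /conj_scale /uncj /cj scalerA rmorphM. Qed.

Fact conj_scale1 : left_id 1 conj_scale.
Proof. by move=> v; rewrite /conj_scale /uncj /cj rmorph1 scale1r. Qed.

Fact conj_scaleDr : right_distributive conj_scale +%R.
Proof. by move=> k u v; exact: (scalerDr (k^*) (u : V)). Qed.

Fact conj_scaleDl v : {morph conj_scale^~ v : k l / k + l}.
Proof. by move=> k l; rewrite /conj_scale rmorphD; exact: scalerDl. Qed.

HB.instance Definition _ := GRing.Zmodule_isLmodule.Build C (conj_space V)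
  conj_scaleA conj_scale1 conj_scaleDr conj_scaleDl.

End Space.

Section ConjBimodule.
Variables (B : starAlgebra C) (M : bimodule B).

Lemma starZD (k : C) (b c : B) : star (k *: b + c) = k^* *: star b + star c.
Proof. exact: star_conj. Qed.

Lemma star1 : star (1 : B) = 1.
Proof. by rewrite -[LHS]mulr1 -{2}[1]starK -starM mulr1 starK. Qed.

Definition conj_lact (b : B) (x : conj_space M) : conj_space M :=
  cj (ract (uncj x) (star b)).
Definition conj_ract (x : conj_space M) (b : B) : conj_space M :=
  cj (lact (star b) (uncj x)).

Definition conj_bimod : bimodule B.
Proof.
refine (@Bimodule C B (conj_space M) conj_lact conj_ract _ _ _ _ _ _ _ _ _).
- by move=> m; rewrite /conj_lact star1 ract1.
- by move=> b c m; rewrite /conj_lact starM ractM.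
- by move=> m k b c; rewrite /conj_lact starZD ractr.
- by move=> b k m n; exact: ractl.
- by move=> m; rewrite /conj_ract star1 lact1.
- by move=> m b c; rewrite /conj_ract starM lactM.
- by move=> m k b c; rewrite /conj_ract starZD lactl.
- by move=> b k m n; exact: lactr.
- by move=> b m c; rewrite /conj_ract /conj_lact /uncj /cj lractA.
Defined.

End ConjBimodule.

End Conjugate.

Section Calculi.
Variable C : numClosedFieldType.

(* The degree-k component of an algebra of forms with degree-0 part B.        *)
Definition forms (B : lmodType C) (F : nat -> lmodType C) (k : nat) :
    lmodType C :=
  if k is j.+1 then F j else B.

(* The subalgebra generated by B and dB; scalars act through B. Products take *)
(* a proof of k + l = n, to avoid transports along equalities of degrees.     *)
Inductive generated (B : lmodType C) (F : nat -> lmodType C)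
    (wedge : forall k l n, (k + l)%N = n ->
       forms B F k -> forms B F l -> forms B F n)
    (d : forall k, forms B F k -> forms B F k.+1) :
    forall k, forms B F k -> Prop :=
| gen_base (b : forms B F 0) : generated wedge d b
| gen_d (b : forms B F 0) : generated wedge d (d 0 b)
| gen_add k (x y : forms B F k) :
    generated wedge d x -> generated wedge d y -> generated wedge d (x + y)
| gen_wedge k l n (e : (k + l)%N = n) (x : forms B F k) (y : forms B F l) :
    generated wedge d x -> generated wedge d y ->
    generated wedge d (wedge k l n e x y).

Record calculus (B : algType C) := Calculus {
  pos_form : nat -> lmodType C;
  form := forms B pos_form;
  wedge : forall k l n, (k + l)%N = n -> form k -> form l -> form n;
  diff : forall k, {linear form k -> form k.+1};
  wedgel : forall k l n (e : (k + l)%N = n) (c : C) x y z,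
    wedge e (c *: x + y) z = c *: wedge e x z + wedge e y z;
  wedger : forall k l n (e : (k + l)%N = n) (c : C) x y z,
    wedge e x (c *: y + z) = c *: wedge e x y + wedge e x z;
  wedgeA : forall k l m p q n (e1 : (k + l)%N = p) (e2 : (p + m)%N = n)
      (e3 : (l + m)%N = q) (e4 : (k + q)%N = n) x y z,
    wedge e2 (wedge e1 x y) z = wedge e4 x (wedge e3 y z);
  wedge1l : forall k (e : (0 + k)%N = k) x, wedge e (1 : B) x = x;
  wedge1r : forall k (e : (k + 0)%N = k) x, wedge e x (1 : B) = x;
  wedge00 : forall (e : (0 + 0)%N = 0) (b c : B), wedge e b c = b * c;
  diff_diff : forall k (x : form k), diff k.+1 (diff k x) = 0;
  diff_wedge : forall k l n (e : (k + l)%N = n) (e1 : (k.+1 + l)%N = n.+1)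
      (e2 : (k + l.+1)%N = n.+1) (x : form k) (y : form l),
    diff n (wedge e x y) =
      wedge e1 (diff k x) y + (-1) ^+ k *: wedge e2 x (diff l y);
  form_generated : forall k (x : form k), generated wedge diff x
}.

Definition form_bimod (B : algType C) (O : calculus B) (k : nat) : bimodule B.
Proof.
refine (@Bimodule C B (form O k)
  (fun b x => wedge (add0n k) (b : form O 0) x)
  (fun x b => wedge (addn0 k) x (b : form O 0)) _ _ _ _ _ _ _ _ _).
- exact: wedge1l.
- move=> b c m; rewrite -[b * c](wedge00 O (addn0 0)); exact: wedgeA.
- by move=> m c b b'; exact: wedgel.
- by move=> b c m n; exact: wedger.
- exact: wedge1r.
- move=> m b c; rewrite -[b * c](wedge00 O (addn0 0)); symmetry; exact: wedgeA.
- by move=> m c b b'; exact: wedger.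
- by move=> b c m n; exact: wedgel.
- by move=> b m c; exact: wedgeA.
Defined.

Record starCalculus (B : starAlgebra C) := StarCalculus {
  sc_calculus :> calculus B;
  form_star : forall k, form sc_calculus k -> form sc_calculus k;
  form_star_conj : forall k, conjugate_linear (@form_star k);
  form_starK : forall k, involutive (@form_star k);
  form_star0 : forall b : B, @form_star 0 b = star b;
  form_star_diff : forall k (x : form sc_calculus k),
    diff sc_calculus k (form_star x) = form_star (diff sc_calculus k x);
  form_star_wedge : forall k l n (e : (k + l)%N = n) (e' : (l + k)%N = n)
      (x : form sc_calculus k) (y : form sc_calculus l),
    form_star (wedge e x y) =
      (-1) ^+ (k * l) *: wedge e' (form_star y) (form_star x)
}.

(* The covariance of each bimodule of k-forms is [form_coactM] in the cases   *)
(* where one of the two degrees is 0.                                         *)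
Record covStarCalculus (A : hopfStarAlgebra C) (B : comoduleStarAlgebra A) :=
    CovStarCalculus {
  cc_calculus :> starCalculus B;
  form_coact : forall k,
    {linear form cc_calculus k -> (A ⊗ form cc_calculus k)%type};
  form_coactP : forall k, is_coaction (form_coact k);
  form_coact0 : forall b : B, form_coact 0 b = acoact B b;
  form_coactM : forall k l n (e : (k + l)%N = n)
      (x : form cc_calculus k) (y : form cc_calculus l),
    form_coact n (wedge e x y) =
      tmul (wedge e) (form_coact k x) (form_coact l y);
  form_coact_star : forall k (x : form cc_calculus k),
    form_coact k (form_star x) =
      tmap (@star C A) (@form_star B cc_calculus k) (form_coact k x);
  form_coact_diff : forall k (x : form cc_calculus k),
    form_coact k.+1 (diff cc_calculus k x) =
      tmap id (diff cc_calculus k) (form_coact k x)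
}.

End Calculi.

Section Coactions.
Variables (C : numClosedFieldType) (A : hopfStarAlgebra C).
Variable B : comoduleStarAlgebra A.

Definition colinear (V W : lmodType C) (dV : V -> A ⊗ V) (dW : W -> A ⊗ W)
    (f : V -> W) : Prop :=
  forall v, dW (f v) = tmap id f (dV v).

Section One.
Variables (E : bimodule B) (dE : E -> A ⊗ E).

Definition conj_coact (x : conj_bimod E) : A ⊗ conj_bimod E :=
  tlift (fun (a : A) (m : E) => star a ⊗ (cj m : conj_bimod E)) (dE (uncj x)).

(* t is f_(-1) (x) f_(0):                                                     *)
(* f_(-1) (x) f_(0)(m) = S(m_(-1)) f(m_(0))_(-1) (x) f(m_(0))_(0)             *)
Definition is_dual_coact (f : dual_bimod E) (t : A ⊗ dual_bimod E) : Prop :=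
  forall m : E,
    tlift (fun (a : A) (h : dual_bimod E) => a ⊗ h m) t =
    tlift (fun (a : A) (n : E) =>
      tlift (fun (a' : A) (b : B) => (antipode A a * a') ⊗ b) (acoact B (f n)))
      (dE m).

(* [is_dual_coact f] has exactly one solution when E is a covariant bimodule, *)
(* finitely generated and projective as a left B-module.                      *)
Definition dual_coact (f : dual_bimod E) : A ⊗ dual_bimod E :=
  xget 0 [set t | is_dual_coact f t].

End One.

Definition btens_coact (M N : bimodule B) (dM : M -> A ⊗ M) (dN : N -> A ⊗ N) :
    btens_bimod M N -> A ⊗ btens_bimod M N :=
  tlift (fun m n => tmul (@bpure _ _ M N : M -> N -> btens_bimod M N) (dM m) (dN n)).

End Coactions.

Section Metrics.
Variables (C : numClosedFieldType) (A : hopfStarAlgebra C).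
Variables (B : comoduleStarAlgebra A) (O : covStarCalculus B).

Definition Omega1 : bimodule B := form_bimod O 1.
Definition Omega1_star (w : Omega1) : Omega1 := @form_star _ _ O 1 w.
Definition Omega1_coact (w : Omega1) : A ⊗ Omega1 := form_coact O 1 w.
Definition Omega2B : bimodule B := btens_bimod Omega1 Omega1.
Definition Omega2B_coact : Omega2B -> A ⊗ Omega2B :=
  btens_coact Omega1_coact Omega1_coact.

Definition otimes (w e : Omega1) : Omega2B := bpure w e.

(* B (x)_B Omega1 and Omega1 (x)_B B are identified with Omega1.              *)
Definition is_metric (g : Omega2B) (p : Omega2B -> B) : Prop :=
  [/\ is_bimod_hom (p : Omega2B -> regular_bimod B),
      forall w, tlift (fun x y : Omega1 => lact (p (otimes w x)) y) g = w &
      forall w, tlift (fun x y : Omega1 => ract x (p (otimes y w))) g = w].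

Definition covariant_metric (g : Omega2B) (p : Omega2B -> B) : Prop :=
  colinear Omega2B_coact (acoact B) p /\
  colinear (acoact B) Omega2B_coact (fun b : B => lact b g).

Definition dagger : Omega2B -> Omega2B :=
  tlift (fun w e : Omega1 => otimes (Omega1_star e) (Omega1_star w)).

Definition real_covariant_metrics : set (Omega2B * (Omega2B -> B)) :=
  [set gp | [/\ is_metric gp.1 gp.2, covariant_metric gp.1 gp.2 &
                dagger gp.1 = gp.1]].

Definition is_hermitian_metric (E : bimodule B)
    (H : conj_bimod E -> dual_bimod E) : Prop :=
  [/\ is_bimod_hom H, bijective H &
      forall e f : E, star (H (cj e) f) = H (cj f) e].

Definition covariant_hermitian_metrics :
    set (conj_bimod Omega1 -> dual_bimod Omega1) :=
  [set H | is_hermitian_metric H /\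
           colinear (conj_coact Omega1_coact) (dual_coact Omega1_coact) H].

End Metrics.

Arguments real_covariant_metrics {C A B} O _.
Arguments covariant_hermitian_metrics {C A B} O _.

(* Main.v *)
Require Import Defs.
From HB Require Import structures.
From mathcomp Require Import all_boot all_order all_algebra.
From mathcomp Require Import boolp classical_sets functions reals complex.

(** Why the theorem holds. To a metric (g, ( , )) corresponds the sesquilinear
    form <w, conj e> = (w, e^* ), and back. The two metric identities
    say that g is a two-sided inverse of the pairing, so each of g and ( , )
    determines the other ([metric_pairing_unique], [metric_tensor_unique]).

    Nondegeneracy. Read as w = sum (w, g1) g2 and e = sum g1 (g2, e), the metric
    identities show that e |-> ( , e) is a bijection onto the left dual, which
    is the bijectivity of H. Conversely, H and a dual basis (e_i, eps_i) of the
    finitely generated projective module Omega^1 give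
    g = sum_i H^-1(eps_i)^* (x) e_i.

    Reality. If g is inverse to ( , ), then g^dagger is inverse to the flipped
    pairing (w, e) |-> (e^*, w^* )^*. Hence g^dagger = g if and only if the
    pairing equals its flip, and that is the Hermitian symmetry of < , >
    ([metric_real]).

    Covariance. Write d for the coactions. Colinearity of the pairing is
    d(w, e) = w_(-1) e_(-1) (x) (w_(0), e_(0)); colinearity of H, once the dual
    coaction is unfolded, is
    e_(-1) (x) (w, e_(0)) = S(w_(-1)) (w_(0), e)_(-1) (x) (w_(0), e)_(0).
    Each follows from the other by cancelling w_(-1) against the antipode
    ([covariant_pairing_hermitian], [covariant_hermitian_pairing]). The same
    cancellation applied to the coaction of w = sum (w, g1) g2 shows that g is
    coinvariant when the pairing is colinear ([metric_coinvariant]), and then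
    b |-> b g is colinear.

    Sweedler calculations are carried out in the monad A (x) -: if F is linear,
    [abind (d m) F] is m_(-1) F(m_(0)), where A multiplies on the left tensor
    factor. Coactions of products are then iterated binds, and the two antipode
    cancellations are [antipode_coactK] and [coact_antipodeK]. *)

Set Implicit Arguments.
Unset Strict Implicit.
Unset Printing Implicit Defensive.

Import GRing.Theory Num.Theory.
Local Open Scope ring_scope.

(** * Additive and linear maps *)

Lemma additive_sum (U V : zmodType) (f : U -> V)
    (I : Type) (r : seq I) (F : I -> U) :
  {morph f : u v / u + v} ->
  f (\sum_(i <- r) F i) = \sum_(i <- r) f (F i).
Proof.
move=> fD; apply: (big_morph f fD).
by apply: (addrI (f 0)); rewrite -fD !addr0.
Qed.

Section LinearMaps.
Variables (C : comPzRingType) (V W : lmodType C) (f : V -> W).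
Hypothesis lf : linear f.

Lemma linear_map0 : f 0 = 0.
Proof.
by apply: (addrI (f 0)); rewrite -{1}[f 0]scale1r -lf scale1r !addr0.
Qed.

Lemma linear_mapD : {morph f : u v / u + v}.
Proof. by move=> u v; rewrite -[u]scale1r lf !scale1r. Qed.

Lemma linear_mapZ c : {morph f : u / c *: u}.
Proof. by move=> u; rewrite -[c *: u]addr0 lf linear_map0 addr0. Qed.

Lemma linear_map_sum (I : Type) (r : seq I) (F : I -> V) :
  f (\sum_(i <- r) F i) = \sum_(i <- r) f (F i).
Proof. exact: additive_sum linear_mapD. Qed.

End LinearMaps.

(** * Lifting bilinear maps to tensor products *)

Section ComplexTensorLift.
Variable C : comPzRingType.
Implicit Types M N P V W : lmodType C.

Lemma cpure_linearl M N (n : N) : linear (fun m : M => m ⊗ n).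
Proof. by move=> c u v; rewrite [LHS]pureDl [X in X + _]pureZl. Qed.

Lemma cpure_scaler M N c (m : M) (n : N) : m ⊗ (c *: n) = c *: (m ⊗ n).
Proof. by rewrite -[RHS]pureZl; symmetry; exact: pure_bal. Qed.

Lemma cpure_linearr M N (m : M) : linear (fun n : N => m ⊗ n).
Proof. by move=> c u v; rewrite [LHS]pureDr -cpure_scaler. Qed.

Lemma ctens_sum M N (x : (M ⊗ N)%type) : x = \sum_(p <- repr x) p.1 ⊗ p.2.
Proof. exact: tens_sum. Qed.

Section Lift.
Variables (M N V : lmodType C) (f : M -> N -> V).
Hypotheses (fl : forall n, linear (f^~ n)) (fr : forall m, linear (f m)).

Lemma bilinear_balanced :
  balanced (fun (m : M) (c : C) => c *: m) (fun (c : C) (n : N) => c *: n) f.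
Proof.
split=> [n|m|m c n]; first exact: linear_mapD (fl n).
  exact: linear_mapD.
by rewrite (linear_mapZ (fl n)) (linear_mapZ (fr m)).
Qed.

Let scaleC (c : C) (m : M) (k : C) : k *: (c *: m) = c *: (k *: m).
Proof. by rewrite !scalerA mulrC. Qed.

Lemma ctlift_pure m n : tlift f (m ⊗ n) = f m n.
Proof. exact: (tlift_pure scaleC bilinear_balanced). Qed.

Lemma ctlift_linear :
  linear (tlift f : (M ⊗ N)%type -> V).
Proof.
have tD := tliftD scaleC bilinear_balanced.
have t0 : tlift f (0 : (M ⊗ N)%type) = 0.
  by apply: (addrI (tlift f (0 : (M ⊗ N)%type))); rewrite -tD !addr0.
move=> c x y; rewrite tD; congr (_ + _).
elim/tens_ind: x => [|x x' ex ex'|m n]; first by rewrite scaler0 t0 scaler0.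
  by rewrite scalerDr !tD scalerDr ex ex'.
rewrite -[_ *: _]pureZl [LHS]ctlift_pure [X in _ = _ *: X]ctlift_pure.
exact: (linear_mapZ (fl n)).
Qed.

End Lift.

Lemma ctens_linear_ext M N V (f g : (M ⊗ N)%type -> V) :
  linear f -> linear g -> (forall m n, f (m ⊗ n) = g (m ⊗ n)) -> f =1 g.
Proof.
move=> lf lg fg x; rewrite [x]ctens_sum !linear_map_sum //.
by apply: eq_bigr => p _; exact: fg.
Qed.

Section Map.
Variables (M N M' N' : lmodType C) (f : M -> M') (g : N -> N').
Hypotheses (lf : linear f) (lg : linear g).

Let fgl n : linear (fun m => f m ⊗ g n).
Proof. by move=> c u v; rewrite lf cpure_linearl. Qed.

Let fgr m : linear (fun n => f m ⊗ g n).
Proof. by move=> c u v; rewrite lg cpure_linearr. Qed.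

Lemma tmap_pure m n : tmap f g (m ⊗ n) = f m ⊗ g n.
Proof. exact: (ctlift_pure fgl fgr). Qed.

Lemma tmap_linear : linear (tmap f g).
Proof. exact: (ctlift_linear fgl fgr). Qed.

End Map.

End ComplexTensorLift.

Section Assoc.
Variables (C : comPzRingType) (M N P : lmodType C).

Let assoc_inner (p : P) :
  linear (fun t : (M ⊗ N)%type => tlift (fun m n => m ⊗ (n ⊗ p)) t).
Proof.
apply: ctlift_linear => [n|m]; first exact: cpure_linearl.
by move=> c u v; rewrite cpure_linearl cpure_linearr.
Qed.

Let assoc_outer (t : (M ⊗ N)%type) :
  linear (fun p : P => tlift (fun m n => m ⊗ (n ⊗ p)) t).
Proof.
move=> c u v; rewrite /tlift scaler_sumr -big_split; apply: eq_bigr => q _.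
by rewrite !cpure_linearr.
Qed.

Lemma tassoc_linear : linear (@tassoc C M N P).
Proof. exact: ctlift_linear. Qed.

Lemma tassoc_pure (m : M) (n : N) (p : P) :
  tassoc ((m ⊗ n : (M ⊗ N)%type) ⊗ p) = m ⊗ (n ⊗ p : (N ⊗ P)%type).
Proof.
rewrite [LHS](ctlift_pure assoc_inner assoc_outer) ctlift_pure // => [k|k].
  exact: cpure_linearl.
by move=> c u v; rewrite cpure_linearl cpure_linearr.
Qed.

End Assoc.

Section BalancedLift.
Variables (C : comPzRingType) (B : algType C) (M N : bimodule B).

Let ractC (c : C) (m : M) (b : B) : ract (c *: m) b = c *: ract m b.
Proof. exact: ractZl. Qed.

Lemma bpure_linearl (n : N) : linear (fun m : M => bpure m n).
Proof. by move=> c u v; rewrite [LHS]pureDl [X in X + _]pureZl. Qed.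

Lemma bpure_linearr (m : M) : linear (fun n : N => bpure m n).
Proof. by move=> c u v; rewrite [LHS]pureDr -bpureZr. Qed.

Lemma btens_linear_ext (V : lmodType C) (f g : btens M N -> V) :
  linear f -> linear g -> (forall m n, f (bpure m n) = g (bpure m n)) -> f =1 g.
Proof.
move=> lf lg fg x; rewrite [x]tens_sum !linear_map_sum //.
by apply: eq_bigr => p _; exact: fg.
Qed.

Lemma balanced_lift_pure (V : zmodType) (f : M -> N -> V) m n :
  balanced (@ract _ _ M) (@lact _ _ N) f -> tlift f (bpure m n) = f m n.
Proof. by move=> fb; exact: (tlift_pure ractC fb). Qed.

Lemma balanced_liftD (V : zmodType) (f : M -> N -> V) :
  balanced (@ract _ _ M) (@lact _ _ N) f ->
  {morph (tlift f : btens M N -> V) : x y / x + y}.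
Proof. exact: (tliftD ractC). Qed.

Variables (V : lmodType C) (f : M -> N -> V).
Hypotheses (fl : forall n, linear (f^~ n)) (fr : forall m, linear (f m)).
Hypothesis fb : forall m b n, f (ract m b) n = f m (lact b n).

Lemma bilinear_lift_balanced : balanced (@ract _ _ M) (@lact _ _ N) f.
Proof. by split=> [n|m|//]; exact: linear_mapD. Qed.

Lemma btlift_pure m n : tlift f (bpure m n) = f m n.
Proof. exact: balanced_lift_pure bilinear_lift_balanced. Qed.

Lemma btlift_linear : linear (tlift f : btens M N -> V).
Proof.
have tD := balanced_liftD bilinear_lift_balanced.
have t0 : tlift f (0 : btens M N) = 0.
  by apply: (addrI (tlift f (0 : btens M N))); rewrite -tD !addr0.
move=> c x y; rewrite tD; congr (_ + _).
elim/tens_ind: x => [|x x' ex ex'|m n]; first by rewrite scaler0 t0 scaler0.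
  by rewrite scalerDr !tD scalerDr ex ex'.
rewrite -[_ *: _]pureZl [LHS]btlift_pure [X in _ = _ *: X]btlift_pure.
exact: (linear_mapZ (fl n)).
Qed.

End BalancedLift.

(** * Coefficients in an algebra, as a monad *)

Section Writer.
Variables (C : comPzRingType) (A : algType C).
Implicit Types U V W M N P : lmodType C.

Definition amul V (a : A) (x : A ⊗ V) : A ⊗ V := tmap ( *%R a) id x.

Let mulr_lin (a : A) : linear ( *%R a).
Proof. by move=> c u v; rewrite mulrDr -scalerAr. Qed.

Let id_lin V : linear (@id V). Proof. by []. Qed.

Lemma amul_pure V a b (v : V) : amul a (b ⊗ v) = (a * b) ⊗ v.
Proof. exact: tmap_pure. Qed.

Lemma amul_linear V a : linear (@amul V a).
Proof. exact: tmap_linear. Qed.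

Lemma amul_linearl V (x : A ⊗ V) : linear (fun a => amul a x).
Proof.
have l := @amul_linear V.
move=> c a b; elim/tens_ind: x => [|x y ex ey|d v].
- by rewrite !(linear_map0 (l _)) scaler0 addr0.
- by rewrite !(linear_mapD (l _)) ex ey scalerDr addrACA.
- by rewrite !amul_pure mulrDl -scalerAl cpure_linearl.
Qed.

Lemma amulA V a b (x : A ⊗ V) : amul a (amul b x) = amul (a * b) x.
Proof.
have l := @amul_linear V.
elim/tens_ind: x => [|x y ex ey|d v]; first by rewrite !(linear_map0 (l _)).
  by rewrite !(linear_mapD (l _)) ex ey.
by rewrite !amul_pure mulrA.
Qed.

Lemma amul1 V (x : A ⊗ V) : amul 1 x = x.
Proof.
have l := @amul_linear V.
elim/tens_ind: x => [|x y ex ey|d v]; first by rewrite !(linear_map0 (l _)).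
  by rewrite !(linear_mapD (l _)) ex ey.
by rewrite !amul_pure mul1r.
Qed.

(** With [aret] this is the monad structure of A ⊗ -; for x = m_(-1) ⊗ m_(0) it
    is the expression m_(-1) F(m_(0)) of Sweedler calculus. *)
Definition abind V W (x : A ⊗ V) (F : V -> A ⊗ W) : A ⊗ W :=
  tlift (fun a v => amul a (F v)) x.

Definition aret V (v : V) : A ⊗ V := 1 ⊗ v.

Lemma aret_linear V : linear (@aret V).
Proof. exact: cpure_linearr. Qed.

Lemma abindE V W (x : A ⊗ V) (F : V -> A ⊗ W) :
  abind x F = \sum_(p <- repr x) amul p.1 (F p.2).
Proof. by []. Qed.

Lemma eq_abind V W (x : A ⊗ V) (F G : V -> A ⊗ W) :
  F =1 G -> abind x F = abind x G.
Proof. by move=> FG; congr abind; apply/funext. Qed.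

Section Bind.
Variables (V W : lmodType C) (F : V -> A ⊗ W).
Hypothesis lF : linear F.

Let Fl v : linear (fun a => amul a (F v)).
Proof. exact: amul_linearl. Qed.

Let Fr a : linear (fun v => amul a (F v)).
Proof. by move=> c u v; rewrite lF amul_linear. Qed.

Lemma abind_pure a v : abind (a ⊗ v) F = amul a (F v).
Proof. exact: (ctlift_pure Fl Fr). Qed.

Lemma abind_linearl : linear (fun x => abind x F).
Proof. exact: (ctlift_linear Fl Fr). Qed.

Lemma abind_ret v : abind (aret v) F = F v.
Proof. by rewrite abind_pure amul1. Qed.

Lemma abind_amul a x : abind (amul a x) F = amul a (abind x F).
Proof.
move: x; apply: ctens_linear_ext => [c u v|c u v|b v].
- by rewrite amul_linear abind_linearl.
- by rewrite abind_linearl amul_linear.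
- by rewrite amul_pure !abind_pure amulA.
Qed.

(** Only the outer map has to be linear: [abind x G] is by definition a finite
    sum of terms a G(u), whatever G is, and [abind _ F] is A-linear. *)
Lemma abind_assoc U (x : A ⊗ U) (G : U -> A ⊗ V) :
  abind (abind x G) F = abind x (fun u => abind (G u) F).
Proof.
rewrite [in LHS](abindE x) (linear_map_sum abind_linearl).
by apply: eq_bigr => p _; rewrite abind_amul.
Qed.

End Bind.

Lemma abind_linearr U V W (x : A ⊗ V) (F : U -> V -> A ⊗ W) :
  (forall v, linear (fun u : U => F u v)) -> linear (fun u => abind x (F u)).
Proof.
move=> lF c u v; rewrite !abindE scaler_sumr -big_split.
by apply: eq_bigr => p _; rewrite lF amul_linear.
Qed.

Lemma abind_retr V (x : A ⊗ V) : abind x (@aret V) = x.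
Proof.
rewrite abindE [RHS]ctens_sum; apply: eq_bigr => p _.
by rewrite amul_pure mulr1.
Qed.

Lemma tmap_abind V W (f : V -> W) (x : A ⊗ V) :
  tmap id f x = abind x (fun v => aret (f v)).
Proof. by apply: eq_bigr => p _; rewrite amul_pure mulr1. Qed.

(** Products of tensors are iterated binds, in the order in which their
    A-components are multiplied, which matters when A is not commutative. *)
Lemma tmul_abind M N P (mu : M -> N -> P) (x : A ⊗ M) (y : A ⊗ N) :
  tmul mu x y = abind x (fun m => abind y (fun n => aret (mu m n))).
Proof.
apply: eq_bigr => p _; rewrite abindE (linear_map_sum (@amul_linear _ _)).
by apply: eq_bigr => q _; rewrite !amul_pure mulr1.
Qed.

Lemma tmap_id V (x : A ⊗ V) : tmap id id x = x.
Proof. by rewrite [RHS]ctens_sum. Qed.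

End Writer.

Section MapSums.
Variables (C : comPzRingType) (A : algType C) (V W : lmodType C).

Lemma tmap_sum (I : Type) (r : seq I) (f : I -> V -> W) (x : A ⊗ V) :
  tmap id (fun v => \sum_(i <- r) f i v) x = \sum_(i <- r) tmap id (f i) x.
Proof.
rewrite exchange_big; apply: eq_bigr => p _.
exact: (linear_map_sum (cpure_linearr _)).
Qed.

Lemma abind_tmap (U : lmodType C) (g : A -> A) (x : A ⊗ V) (F : V -> A ⊗ U) :
  linear F ->
  abind (tmap g id x) F = tlift (fun a v => amul (g a) (F v)) x.
Proof.
move=> lF; rewrite (linear_map_sum (abind_linearl lF)).
by apply: eq_bigr => p _; rewrite abind_pure.
Qed.

End MapSums.

Section Tmul.
Variables (C : comPzRingType) (A : algType C).
Implicit Types M N P Q U V W : lmodType C.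

(** Any associativity-like law between bilinear maps lifts to A ⊗ -. This covers
    the balancedness, equivariance and contraction identities used below. *)
Lemma tmulA M N P Q V W (mu1 : Q -> P -> W) (mu2 : M -> N -> Q)
    (mu3 : M -> V -> W) (mu4 : N -> P -> V)
    (x : A ⊗ M) (y : A ⊗ N) (z : A ⊗ P) :
  (forall p, linear (fun q => mu1 q p)) -> (forall m, linear (mu3 m)) ->
  (forall m n p, mu1 (mu2 m n) p = mu3 m (mu4 n p)) ->
  tmul mu1 (tmul mu2 x y) z = tmul mu3 x (tmul mu4 y z).
Proof.
move=> lmu1 lmu3 muA; rewrite !tmul_abind.
have lret1 p : linear (fun q => aret A (mu1 q p)).
  by move=> c u v; rewrite lmu1 aret_linear.
have lret3 m : linear (fun v => aret A (mu3 m v)).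
  by move=> c u v; rewrite lmu3 aret_linear.
have lbind1 : linear (fun q => abind z (fun p => aret A (mu1 q p))).
  exact: abind_linearr.
rewrite abind_assoc //; apply: eq_abind => m.
rewrite !abind_assoc //; apply: eq_abind => n.
rewrite abind_ret // abind_assoc //; apply: eq_abind => p.
by rewrite abind_ret ?muA.
Qed.

Lemma tmap_tmul M N P Q (f : P -> Q) (mu : M -> N -> P)
    (x : A ⊗ M) (y : A ⊗ N) :
  linear f -> tmap id f (tmul mu x y) = tmul (fun m n => f (mu m n)) x y.
Proof.
move=> lf; rewrite tmap_abind !tmul_abind.
have lret : linear (fun p => aret A (f p)) by move=> c u v; rewrite lf aret_linear.
rewrite abind_assoc //; apply: eq_abind => m.
by rewrite abind_assoc //; apply: eq_abind => n; rewrite abind_ret.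
Qed.

Lemma tmul_tmap M N P (mu : M -> N -> P) (x : A ⊗ M) (y : A ⊗ N) :
  tmul mu x y = abind x (fun m => tmap id (mu m) y).
Proof. by rewrite tmul_abind; apply: eq_abind => m; rewrite tmap_abind. Qed.

Lemma tmul_retr M N P (mu : M -> N -> P) (x : A ⊗ M) n :
  (forall m, linear (mu m)) ->
  tmul mu x (aret A n) = tmap id (mu^~ n) x.
Proof.
move=> lmu; rewrite tmul_abind tmap_abind; apply: eq_abind => m.
by rewrite abind_ret // => c u v; rewrite lmu aret_linear.
Qed.

Lemma tmul_linearr M N P (mu : M -> N -> P) (x : A ⊗ M) :
  (forall m, linear (mu m)) -> linear (tmul mu x).
Proof.
move=> lmu c u v; rewrite !tmul_tmap.
have l m : linear (fun w : A ⊗ N => tmap id (mu m) w) by exact: tmap_linear.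
exact: (@abind_linearr _ _ _ _ _ x (fun w m => tmap id (mu m) w) l).
Qed.

Lemma tmul_linearl M N P (mu : M -> N -> P) (y : A ⊗ N) :
  (forall n, linear (mu^~ n)) -> linear (fun x => tmul mu x y).
Proof.
move=> lmu c u v; rewrite !tmul_abind abind_linearl //.
by apply: abind_linearr => n d w z; rewrite lmu aret_linear.
Qed.

Lemma eq_tmap V W (f g : V -> W) (x : A ⊗ V) :
  f =1 g -> tmap id f x = tmap id g x.
Proof. by move=> fg; congr tmap; apply/funext. Qed.

Lemma tmap_comp U V W (f : V -> W) (h : U -> V) (x : A ⊗ U) : linear f ->
  tmap id f (tmap id h x) = tmap id (fun u => f (h u)) x.
Proof.
move=> lf; have lret : linear (fun p => aret A (f p)).
  by move=> c u v; rewrite lf aret_linear.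
rewrite !tmap_abind abind_assoc //; apply: eq_abind => u; exact: abind_ret.
Qed.

End Tmul.

(** * Cancelling the antipode *)

Section Counit.
Variables (C : numClosedFieldType) (A : hopfStarAlgebra C).

Let scale_l (U : lmodType C) (w : U) : linear (fun a : A => (counit A a : C) *: w).
Proof. by move=> c u v; rewrite linearP scalerDl scalerA. Qed.

Let scale_r (U : lmodType C) (a : A) : linear (fun w : U => (counit A a : C) *: w).
Proof. by move=> c u v; rewrite scalerDr !scalerA mulrC. Qed.

Definition counit_map (U : lmodType C) (x : (A ⊗ U)%type) : U :=
  tlift (fun (a : A) (w : U) => (counit A a : C) *: w) x.

Lemma counit_map_linear (U : lmodType C) : linear (@counit_map U).
Proof. exact: ctlift_linear. Qed.

Lemma counit_map_pure (U : lmodType C) (a : A) (w : U) :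
  counit_map (a ⊗ w) = (counit A a : C) *: w.
Proof. exact: ctlift_pure. Qed.

Lemma counit_map_tmap (V W : lmodType C) (f : V -> W) (x : (A ⊗ V)%type) :
  linear f -> counit_map (tmap id f x) = f (counit_map x).
Proof.
move=> lf; rewrite (linear_map_sum (@counit_map_linear W)) (linear_map_sum lf).
by apply: eq_bigr => q _; rewrite counit_map_pure (linear_mapZ lf).
Qed.

End Counit.

Section Antipode.
Variables (C : numClosedFieldType) (A : hopfStarAlgebra C) (M : lmodType C).
Variable delta : {linear M -> (A ⊗ M)%type}.
Hypothesis deltaP : is_coaction delta.

Let delta_lin : linear delta. Proof. exact: linearP. Qed.
Let S_lin : linear (antipode A). Proof. exact: linearP. Qed.
Let comul_lin : linear (comul A). Proof. exact: linearP. Qed.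
Let idM : linear (@id M). Proof. by []. Qed.
Let idA : linear (@id A). Proof. by []. Qed.

Section Convolution.
Variables f g : A -> A.
Hypotheses (lf : linear f) (lg : linear g).

Definition convolution (a : A) : A := tlift (fun x y => f x * g y) (comul A a).

Let mul_l (b : A) : linear (fun x => f x * g b).
Proof. by move=> c u v; rewrite lf mulrDl -scalerAl. Qed.

Let mul_r (b : A) : linear (fun y => f b * g y).
Proof. by move=> c u v; rewrite lg mulrDr -scalerAr. Qed.

Lemma convolution_linear : linear convolution.
Proof.
by move=> c a b; rewrite /convolution comul_lin (ctlift_linear mul_l mul_r).
Qed.

Let twist (a : A) (x : (A ⊗ M)%type) : (A ⊗ M)%type := amul (f a) (tmap g id x).

Let twist_l x : linear (twist^~ x).
Proof. by move=> c u v; rewrite /twist lf amul_linearl. Qed.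

Let twist_r a : linear (twist a).
Proof. by move=> c u v; rewrite /twist (tmap_linear lg idM) amul_linear. Qed.

(** Coassociativity: f(m_(-2)) g(m_(-1)) ⊗ m_(0) is unambiguous, so that acting
    successively by f and g on the comodule M is acting by f * g. With f or g the
    antipode and the other one the identity, f * g is the counit. *)
Lemma abind_convolution m :
  abind (tmap f id (delta m)) (fun n => tmap g id (delta n)) =
  tmap convolution id (delta m).
Proof.
have lF : linear (fun n => tmap g id (delta n)).
  by move=> c u v; rewrite delta_lin (tmap_linear lg idM).
have -> (x : (A ⊗ M)%type) :
    abind (tmap f id x) (fun n => tmap g id (delta n)) =
    tlift twist (tmap id delta x).
  move: x; apply: ctens_linear_ext => [c u v|c u v|a n].
  - by rewrite (tmap_linear lf idM) (abind_linearl lF).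
  - by rewrite (tmap_linear idA delta_lin) (ctlift_linear twist_l twist_r).
  - by rewrite !tmap_pure // (abind_pure lF) (ctlift_pure twist_l twist_r).
rewrite deltaP.1; move: (delta m); apply: ctens_linear_ext => [c u v||a n].
- rewrite (tmap_linear comul_lin idM) tassoc_linear.
  exact: (ctlift_linear twist_l twist_r).
- exact: tmap_linear convolution_linear idM.
rewrite (tmap_pure comul_lin idM) (tmap_pure convolution_linear idM).
rewrite /convolution; move: (comul A a).
apply: ctens_linear_ext => [c u v|c u v|b b'].
- by rewrite cpure_linearl tassoc_linear (ctlift_linear twist_l twist_r).
- by rewrite (ctlift_linear mul_l mul_r) cpure_linearl.
rewrite tassoc_pure (ctlift_pure twist_l twist_r) (ctlift_pure mul_l mul_r).
by rewrite /twist tmap_pure // amul_pure.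
Qed.

End Convolution.

Lemma tmap_counit m : tmap (fun a => (counit A a : C)%:A) id (delta m) = aret A m.
Proof.
rewrite -{2}[m]deltaP.2 -/(counit_map _); move: (delta m).
have lc : linear (fun a : A => (counit A a : C)%:A : A).
  by move=> c u v; rewrite linearP scalerDl scalerA.
apply: ctens_linear_ext => [||a n]; first exact: tmap_linear.
  by move=> c u v; rewrite counit_map_linear aret_linear.
rewrite tmap_pure // counit_map_pure /aret cpure_scaler.
by rewrite (linear_mapZ (cpure_linearl _)).
Qed.

Definition antipode_coact (m : M) : (A ⊗ M)%type :=
  tmap (antipode A) id (delta m).

(** In Sweedler notation S(m_(-2)) m_(-1) F(m_(0)) = F(m), where S(m_(-2)) m_(-1)
    collapses to the counit by coassociativity and the antipode axiom. *)
Lemma antipode_coactK (W : lmodType C) (F : M -> (A ⊗ W)%type) m : linear F ->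
  abind (antipode_coact m) (fun n => abind (delta n) F) = F m.
Proof.
move=> lF; rewrite -(abind_assoc lF).
have dE : delta =1 fun n => tmap id id (delta n) by move=> n; rewrite tmap_id.
rewrite [abind (antipode_coact m) _](eq_abind _ dE) (abind_convolution S_lin idA).
rewrite -[RHS](abind_ret lF) -tmap_counit.
by congr (abind (tmap _ _ _) _); apply/funext => a; exact: antipodel.
Qed.

(** The mirror identity m_(-2) S(m_(-1)) F(m_(0)) = F(m), from the other antipode
    axiom. *)
Lemma coact_antipodeK (W : lmodType C) (F : M -> (A ⊗ W)%type) m : linear F ->
  abind (delta m) (fun n => abind (antipode_coact n) F) = F m.
Proof.
move=> lF; rewrite -(abind_assoc lF) -{1}[delta m]tmap_id.
rewrite (abind_convolution idA S_lin) -[RHS](abind_ret lF) -tmap_counit.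
by congr (abind (tmap _ _ _) _); apply/funext => a; exact: antipoder.
Qed.

End Antipode.

(** * Bimodules: dual bases and covariance *)

Section BimoduleMaps.
Variables (C : comPzRingType) (B : algType C).
Implicit Types M N : bimodule B.

Lemma lact_linearr M (b : B) : linear (@lact _ _ M b).
Proof. by move=> c u v; exact: lactr. Qed.

Lemma lact_linearl M (m : M) : linear (fun b : B => lact b m).
Proof. by move=> c u v; exact: lactl. Qed.

Lemma ract_linearr M (m : M) : linear (@ract _ _ M m).
Proof. by move=> c u v; exact: ractr. Qed.

Lemma bimod_hom_linear M N (f : M -> N) : is_bimod_hom f -> linear f.
Proof.
move=> [fD fl _] c u v; rewrite fD; congr (_ + _).
by rewrite -[c *: u in LHS]lact1 lactZr -lactZl fl lactZl lact1.
Qed.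

End BimoduleMaps.

Section DualBasis.
Variables (C : comPzRingType) (B : algType C) (M : bimodule B).

(** A copy of M, to carry the structure of a module over B beside the structure
    of a complex vector space that M already has. *)
Definition left_module : Type := M.
HB.instance Definition _ := GRing.Zmodule.on left_module.

Let lactA (b c : B) (m : left_module) :
  lact b (lact c m : M) = lact (b * c) m :> left_module.
Proof. by rewrite lactM. Qed.

HB.instance Definition _ := GRing.Zmodule_isLmodule.Build B left_module
  lactA (@lact1 _ _ M) (fun b => @lactDr _ _ M b) (fun m => @lactDl _ _ M m).

(** Generators e_i give a surjection from the free module B^n to M; projectivity
    splits it, and eps_i is the i-th coordinate of the splitting. *)
Lemma dual_basis : left_fin_gen M -> left_projective M ->
  exists (n : nat) (e : 'I_n -> M) (eps : 'I_n -> left_dual M),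
    forall m, m = \sum_(i < n) lact (eps i m) (e i).
Proof.
move=> [n [e eP]] projM.
pose comb (v : 'rV[B]_n) : left_module := \sum_(i < n) lact (v 0 i) (e i).
have comb_lin : linear comb.
  move=> b u v; rewrite /comb scaler_sumr -big_split; apply: eq_bigr => i _.
  by rewrite !mxE [LHS]lactDl lactM.
pose combL : {linear 'rV[B]_n -> left_module} :=
  HB.pack comb (GRing.isLinear.Build B 'rV[B]_n left_module *:%R comb comb_lin).
have [||h [hD hZ] hK] := projM _ _ combL (fun m : M => m : left_module).
- move=> m; have [b ->] := eP m; exists (\row_i b i).
  by apply: eq_bigr => i _; rewrite mxE.
- by [].
have coordP i : (fun m => h m 0 i) \in @left_linear_pred _ _ M.
  by apply/asboolP; split=> [m m'|b m]; rewrite ?hD ?hZ mxE.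
exists n, e, (fun i => LeftDual (coordP i)) => m.
by rewrite -{1}[m]hK.
Qed.

End DualBasis.

Section CovariantTensor.
Variables (C : numClosedFieldType) (A : hopfStarAlgebra C).
Variable B : comoduleStarAlgebra A.

Record covariant_bimodule (M : bimodule B) (dM : M -> A ⊗ M) : Prop :=
  CovariantBimodule {
    cov_linear : linear dM;
    cov_lact : forall b m, dM (lact b m) = tmul (@lact _ _ M) (acoact B b) (dM m);
    cov_ract : forall m b, dM (ract m b) = tmul (@ract _ _ M) (dM m) (acoact B b)
  }.

Variables (M N : bimodule B) (dM : M -> A ⊗ M) (dN : N -> A ⊗ N).
Hypotheses (covM : covariant_bimodule dM) (covN : covariant_bimodule dN).

Let mu : M -> N -> btens_bimod M N := @bpure _ _ M N.

Let mu_l n : linear (mu^~ n). Proof. exact: bpure_linearl. Qed.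
Let mu_r m : linear (mu m). Proof. exact: bpure_linearr. Qed.

Let coact_l n : linear (fun m => tmul mu (dM m) (dN n)).
Proof. by move=> c u v; rewrite (cov_linear covM) tmul_linearl. Qed.

Let coact_r m : linear (fun n => tmul mu (dM m) (dN n)).
Proof. by move=> c u v; rewrite (cov_linear covN) tmul_linearr. Qed.

Let coact_bal m b n :
  tmul mu (dM (ract m b)) (dN n) = tmul mu (dM m) (dN (lact b n)).
Proof.
rewrite (cov_ract covM) (cov_lact covN); apply: tmulA => //.
move=> x c y; exact: pure_bal.
Qed.

Lemma btens_coact_linear : linear (btens_coact dM dN).
Proof. exact: (btlift_linear coact_l coact_r coact_bal). Qed.

(** The diagonal coaction respects the relation m b ⊗ n = m ⊗ b n because the
    coactions of M and N are compatible with the actions of B. *)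
Lemma btens_coact_pure m n :
  btens_coact dM dN (bpure m n) = tmul mu (dM m) (dN n).
Proof. exact: (btlift_pure coact_l coact_r coact_bal). Qed.

Lemma btens_coact_lact b (t : btens_bimod M N) :
  btens_coact dM dN (lact b t) =
  tmul (@lact _ _ (btens_bimod M N)) (acoact B b) (btens_coact dM dN t).
Proof.
move: t; apply: btens_linear_ext => [c u v|c u v|m n].
- by rewrite lact_linearr btens_coact_linear.
- rewrite btens_coact_linear tmul_linearr // => b'; exact: lact_linearr.
rewrite [lact b _]btens_lact_pure !btens_coact_pure (cov_lact covM).
apply: tmulA => // [b'|b' x y]; first exact: lact_linearr.
by symmetry; exact: btens_lact_pure.
Qed.

End CovariantTensor.

Section DualCoaction.
Variables (C : numClosedFieldType) (A : hopfStarAlgebra C).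
Variables (B : comoduleStarAlgebra A) (E : bimodule B).
Variable dE : {linear E -> (A ⊗ E)%type}.

Lemma dual_eval_linear (m : E) : linear (fun h : dual_bimod E => h m).
Proof. by []. Qed.

Lemma dual_linear (f : dual_bimod E) : linear f.
Proof. by move=> c u v; rewrite (dualP f).1 dualZ. Qed.

Let coact_dual_linear (f : dual_bimod E) : linear (fun n => acoact B (f n)).
Proof. by move=> c u v; rewrite dual_linear linearP. Qed.

(** The characterization of f_(-1) ⊗ f_(0) by its values on E, in monadic form:
    f_(-1) ⊗ f_(0)(m) = S(m_(-1)) d(f(m_(0))). *)
Lemma is_dual_coactE f t :
  is_dual_coact dE f t <->
  forall m, tmap id (fun h : dual_bimod E => h m) t =
            abind (antipode_coact dE m) (fun n => acoact B (f n)).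
Proof.
by split=> H m; rewrite [LHS]H (abind_tmap _ _ (coact_dual_linear f)).
Qed.

Variables (n : nat) (e : 'I_n -> E) (eps : 'I_n -> left_dual E).
Hypothesis dual_basisP : forall m, m = \sum_(i < n) lact (eps i m) (e i).

Lemma dual_basis_dual (h : dual_bimod E) :
  h = \sum_(i < n) ract (eps i : dual_bimod E) (h (e i)).
Proof.
apply: dual_ext => m; rewrite {1}[m]dual_basisP.
rewrite (linear_map_sum (dual_linear h)) (linear_map_sum (dual_eval_linear m)).
by apply: eq_bigr => i _; exact: (dualP h).2.
Qed.

(** Finitely many evaluations recover t: since h = sum_i eps_i h(e_i), the
    tensor t is the sum of the images under eps_i of its values at e_i. *)
Lemma dual_tensor_ext (t t' : (A ⊗ dual_bimod E)%type) :
  (forall m, tmap id (fun h : dual_bimod E => h m) t =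
             tmap id (fun h : dual_bimod E => h m) t') -> t = t'.
Proof.
have tE (u : (A ⊗ dual_bimod E)%type) : u =
    \sum_(i < n) tmap id (@ract _ _ (dual_bimod E) (eps i))
                   (tmap id (fun h : dual_bimod E => h (e i)) u).
  rewrite -[LHS]tmap_id (eq_tmap _ dual_basis_dual) tmap_sum.
  by apply: eq_bigr => i _; rewrite tmap_comp //; exact: ract_linearr.
by move=> tt'; rewrite [t]tE [t']tE; apply: eq_bigr => i _; rewrite tt'.
Qed.

Lemma dual_coactP f t : is_dual_coact dE f t -> dual_coact dE f = t.
Proof.
move=> ft; apply: xget_unique => // t' /is_dual_coactE ft'.
by move/is_dual_coactE: ft => ft; apply: dual_tensor_ext => m; rewrite ft ft'.
Qed.

End DualCoaction.

(** * Metrics and Hermitian metrics *)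

Section Metrics.
Variables (C : numClosedFieldType) (A : hopfStarAlgebra C).
Variables (B : comoduleStarAlgebra A) (O : covStarCalculus B).

Local Notation E := (Omega1 O).
Local Notation E2 := (Omega2B O).
Local Notation st := (@Omega1_star C A B O).
Local Notation dE := (form_coact O 1 : {linear E -> (A ⊗ E)%type}).
Local Notation dE2 := (@Omega2B_coact C A B O).
Local Notation contract p w :=
  (tlift (fun x y : E => lact (p (otimes w x)) y)).
Implicit Types (w e : E) (b : B) (t g : E2) (p : E2 -> B).

Lemma Omega1_starD : {morph st : u v / u + v}.
Proof.
by move=> u v; have := form_star_conj 1 u v; rewrite rmorph1 !scale1r => <-.
Qed.

Lemma Omega1_starK : involutive st. Proof. exact: form_starK. Qed.

Lemma Omega1_star_lact b w : st (lact b w) = ract (st w) (star b).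
Proof.
by rewrite [LHS](form_star_wedge _ (addn0 1)) expr0 scale1r form_star0.
Qed.

Lemma Omega1_star_ract w b : st (ract w b) = lact (star b) (st w).
Proof.
by rewrite [LHS](form_star_wedge _ (add0n 1)) expr0 scale1r form_star0.
Qed.

Lemma covariant_Omega1 : covariant_bimodule dE.
Proof.
split=> [|b m|m b]; first exact: linearP.
  by rewrite [LHS]form_coactM form_coact0.
by rewrite [LHS]form_coactM form_coact0.
Qed.

Let dEP : is_coaction dE := form_coactP O 1.

Lemma Omega1_coact_star w : dE (st w) = tmap (@star C A) st (dE w).
Proof. exact: form_coact_star. Qed.

Lemma starD : {morph (@star C B) : b c / b + c}.
Proof. by move=> b c; have := starZD 1 b c; rewrite rmorph1 !scale1r. Qed.

Lemma otimesDl e : {morph (@otimes _ _ _ O)^~ e : w w' / w + w'}.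
Proof. exact: linear_mapD (bpure_linearl _). Qed.

Lemma otimesDr w : {morph @otimes _ _ _ O w : e e' / e + e'}.
Proof. exact: linear_mapD (bpure_linearr _). Qed.

Lemma otimes_bal w b e : otimes (ract w b) e = otimes w (lact b e).
Proof. exact: pure_bal. Qed.

(** Well defined over B because * exchanges the left and right actions. *)
Lemma dagger_balanced :
  balanced (@ract _ _ E) (@lact _ _ E) (fun w e => otimes (st e) (st w)).
Proof.
split=> [e w w'|w e e'|w b e]; first by rewrite Omega1_starD otimesDr.
  by rewrite Omega1_starD otimesDl.
by rewrite Omega1_star_ract Omega1_star_lact otimes_bal.
Qed.

Lemma daggerD : {morph @dagger _ _ _ O : t t' / t + t'}.
Proof. exact: balanced_liftD dagger_balanced. Qed.

Lemma dagger0 : dagger (0 : E2) = 0.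
Proof. by apply: (addrI (dagger (0 : E2))); rewrite -daggerD !addr0. Qed.

Lemma dagger_otimes w e : dagger (otimes w e) = otimes (st e) (st w).
Proof. exact: (balanced_lift_pure w e dagger_balanced). Qed.

Lemma dagger_lact b t : dagger (lact b t) = ract (dagger t) (star b).
Proof.
elim/tens_ind: t => [|t t' et et'|w e].
- by rewrite lact0r dagger0 ract0l.
- by rewrite lactDr !daggerD et et' ractDl.
rewrite [lact b _]btens_lact_pure [RHS]/= [LHS]dagger_otimes [in RHS]dagger_otimes.
by rewrite [RHS]btens_ract_pure Omega1_star_lact.
Qed.

Lemma dagger_ract b t : dagger (ract t b) = lact (star b) (dagger t).
Proof.
elim/tens_ind: t => [|t t' et et'|w e].
- by rewrite ract0l dagger0 lact0r.
- by rewrite ractDl !daggerD et et' lactDr.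
rewrite [ract _ b]btens_ract_pure [LHS]dagger_otimes [in RHS]dagger_otimes.
by rewrite [RHS]btens_lact_pure Omega1_star_ract.
Qed.

Definition is_pairing p : Prop := is_bimod_hom (p : E2 -> regular_bimod B).

Section Pairing.
Variable p : E2 -> B.
Hypothesis pP : is_pairing p.

Lemma pairingD : {morph p : t t' / t + t'}. Proof. by case: pP. Qed.

Lemma pairing_lact b w e : p (otimes (lact b w) e) = b * p (otimes w e).
Proof.
by case: pP => _ pl _; rewrite -[RHS]pl; congr p; rewrite [RHS]btens_lact_pure.
Qed.

Lemma pairing_ract w e b : p (otimes w (ract e b)) = p (otimes w e) * b.
Proof.
by case: pP => _ _ pr; rewrite -[RHS]pr; congr p; rewrite [RHS]btens_ract_pure.
Qed.

Lemma pairingDl e : {morph (fun w => p (otimes w e)) : w w' / w + w'}.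
Proof. by move=> w w'; rewrite otimesDl pairingD. Qed.

Lemma pairingDr w : {morph (fun e => p (otimes w e)) : e e' / e + e'}.
Proof. by move=> e e'; rewrite otimesDr pairingD. Qed.

Lemma contractl_balanced w :
  balanced (@ract _ _ E) (@lact _ _ E) (fun x y => lact (p (otimes w x)) y).
Proof.
split=> [y x x'|x y y'|x b y]; first by rewrite pairingDr lactDl.
  exact: lactDr.
by rewrite pairing_ract lactM.
Qed.

Lemma contractr_balanced w :
  balanced (@ract _ _ E) (@lact _ _ E) (fun x y => ract x (p (otimes y w))).
Proof.
split=> [y x x'|x y y'|x b y]; first exact: ractDl.
  by rewrite pairingDl ractDr.
by rewrite pairing_lact ractM.
Qed.

End Pairing.

Lemma pairing_ext p p' : is_pairing p -> is_pairing p' ->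
  (forall w e, p (otimes w e) = p' (otimes w e)) -> p = p'.
Proof.
move=> pP p'P pp'; apply/funext => t; rewrite [t]tens_sum.
rewrite (additive_sum _ _ (pairingD pP)) (additive_sum _ _ (pairingD p'P)).
by apply: eq_bigr => q _; exact: pp'.
Qed.

(** Uniqueness of inverses: p(w, e) = sum p'(w, g1) p(g2, e) = p'(w, e), by the
    left identity of p' and the right identity of p. *)
Lemma metric_pairing_unique g p p' : is_metric g p -> is_metric g p' -> p = p'.
Proof.
move=> [pP _ pr] [p'P pl _]; apply: pairing_ext => // w e.
rewrite -{1}[w]pl -{2}[e]pr /tlift (additive_sum _ _ (pairingDl pP e)).
rewrite (additive_sum _ _ (pairingDr p'P w)); apply: eq_bigr => q _.
by rewrite pairing_lact // pairing_ract.
Qed.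

(** Uniqueness of inverses on the other side: both tensors are equal to
    sum g1 (g2, g1') ⊗ g2'. *)
Lemma metric_tensor_unique g g' p : is_metric g p -> is_metric g' p -> g = g'.
Proof.
move=> [pP _ pr] [_ pl _].
(* the tensor sum g1 (g2, g1') ⊗ g2' with q = (g1, g2) and q' = (g1', g2') *)
transitivity (\sum_(q <- repr g) \sum_(q' <- repr g')
    otimes (ract q.1 (p (otimes q.2 q'.1))) q'.2).
  rewrite {1}[g]tens_sum; apply: eq_bigr => q _.
  rewrite -{1}[q.2]pl -[LHS]/(otimes _ _) (additive_sum _ _ (otimesDr _)).
  by apply: eq_bigr => q' _; rewrite otimes_bal.
rewrite exchange_big {2}[g']tens_sum; apply: eq_bigr => q' _.
rewrite -{2}[q'.1]pr -[RHS]/(otimes _ _).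
by rewrite (additive_sum _ _ (otimesDl _)).
Qed.

(** The pairing (w, e) |-> (e^*, w^* )^*. *)
Definition flip_pairing p (t : E2) : B := star (p (dagger t)).

Lemma flip_pairing_otimes p w e :
  flip_pairing p (otimes w e) = star (p (otimes (st e) (st w))).
Proof. by rewrite /flip_pairing dagger_otimes. Qed.

Lemma flip_is_pairing p : is_pairing p -> is_pairing (flip_pairing p).
Proof.
move=> [pD pl pr]; split=> [t t'|b t|t b]; rewrite /flip_pairing.
- by rewrite daggerD pD starD.
- by rewrite dagger_lact pr starM starK.
- by rewrite dagger_ract pl starM starK.
Qed.

(** Applying * to the right identity of (g, p) at w^* gives the left identity of
    the pair (dagger g, flip p) at w, and conversely. *)
Lemma dagger_metric g p : is_metric g p -> is_metric (dagger g) (flip_pairing p).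
Proof.
move=> [pP pl pr]; have fP := flip_is_pairing pP; split=> // w.
- rewrite (additive_sum _ _ (balanced_liftD (contractl_balanced fP w))).
  rewrite -[RHS]Omega1_starK -[st w]pr (additive_sum _ _ Omega1_starD).
  apply: eq_bigr => q _.
  rewrite (balanced_lift_pure _ _ (contractl_balanced fP w)).
  by rewrite flip_pairing_otimes Omega1_starK Omega1_star_ract.
- rewrite (additive_sum _ _ (balanced_liftD (contractr_balanced fP w))).
  rewrite -[RHS]Omega1_starK -[st w]pl (additive_sum _ _ Omega1_starD).
  apply: eq_bigr => q _.
  rewrite (balanced_lift_pure _ _ (contractr_balanced fP w)).
  by rewrite flip_pairing_otimes Omega1_starK Omega1_star_lact.
Qed.

(** If dagger g = g then p and its flip are inverse to the same tensor; if p is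
    its own flip then g and dagger g are inverse to the same pairing. *)
Lemma metric_real g p : is_metric g p -> dagger g = g <-> flip_pairing p = p.
Proof.
move=> gp; have dgP := dagger_metric gp; split=> [gg|pp].
  by rewrite gg in dgP; exact: metric_pairing_unique dgP gp.
by rewrite pp in dgP; exact: metric_tensor_unique dgP gp.
Qed.

Lemma metric_nondegenerate g p e e' : is_metric g p ->
  (forall w, p (otimes w e) = p (otimes w e')) -> e = e'.
Proof.
move=> [_ _ pr] ee'; rewrite -[e]pr -[e']pr.
by apply: eq_bigr => q _; rewrite ee'.
Qed.

(** The representing form is sum g1 f(g2): pair it with w and use
    w = sum (w, g1) g2. *)
Lemma metric_represents g p (f : left_dual E) : is_metric g p ->
  exists e, forall w, p (otimes w e) = f w.
Proof.
move=> [pP pl _]; have [fD fl] := dualP f.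
exists (\sum_(q <- repr g) ract q.1 (f q.2)) => w.
rewrite (additive_sum _ _ (pairingDr pP w)) -[in RHS](pl w) (additive_sum _ _ fD).
by apply: eq_bigr => q _; rewrite pairing_ract // fl.
Qed.

(** Total in p: the default 0 is taken when w |-> p(w, e^* ) is not left linear,
    which does not happen for a pairing. *)
Definition hermitian_of p (x : conj_bimod E) : dual_bimod E :=
  insubd (0 : left_dual E) (fun w => p (otimes w (st (uncj x)))).

Lemma hermitian_ofE p e w : is_pairing p ->
  hermitian_of p (cj e) w = p (otimes w (st e)).
Proof.
move=> pP; rewrite /hermitian_of.
have := @insubdK _ _ (left_dual E) 0 (fun w => p (otimes w (st e))).
rewrite /= => -> //; apply/asboolP; split; first exact: pairingDl.
by move=> b m; exact: pairing_lact.
Qed.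

Lemma hermitian_of_bimod_hom p : is_pairing p -> is_bimod_hom (hermitian_of p).
Proof.
move=> pP; split=> [x y|b x|x b]; apply: dual_ext => w.
- rewrite [LHS](hermitian_ofE (uncj x + uncj y : E) w pP) Omega1_starD.
  by rewrite pairingDr // -!hermitian_ofE.
- rewrite [LHS](hermitian_ofE (ract (uncj x : E) (star b)) w pP) Omega1_star_ract.
  by rewrite starK -otimes_bal -hermitian_ofE.
- rewrite [LHS](hermitian_ofE (lact (star b) (uncj x : E)) w pP) Omega1_star_lact.
  by rewrite starK pairing_ract // -hermitian_ofE.
Qed.

Lemma hermitian_of_metric g p : is_metric g p -> dagger g = g ->
  is_hermitian_metric (hermitian_of p).
Proof.
move=> gp gg; have [pP _ _] := gp; have /(metric_real gp) pp := gg.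
split; first exact: hermitian_of_bimod_hom.
- have rep (f : dual_bimod E) : exists x, hermitian_of p x = f.
    have [e ef] := metric_represents f gp; exists (cj (st e)).
    by apply: dual_ext => w; rewrite hermitian_ofE // Omega1_starK.
  exists (fun f => projT1 (cid (rep f))) => [x|f]; last by case: cid.
  case: cid => y /= yx; apply: (can_inj Omega1_starK).
  apply: (metric_nondegenerate gp) => w.
  by rewrite -!hermitian_ofE // [X in dual_fun X]yx.
- move=> e f; rewrite !hermitian_ofE // -[in RHS]pp flip_pairing_otimes.
  by rewrite Omega1_starK.
Qed.

Definition pairing_of (H : conj_bimod E -> dual_bimod E) : E2 -> B :=
  tlift (fun w e => H (cj (st e)) w).

Section PairingOf.
Variables (H : conj_bimod E -> dual_bimod E).
Hypothesis H_hom : is_bimod_hom H.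

Lemma pairing_of_balanced :
  balanced (@ract _ _ E) (@lact _ _ E) (fun w e => H (cj (st e)) w).
Proof.
have [HD Hl Hr] := H_hom; split=> [e|w e e'|w b e].
- exact: (dualP _).1.
- by rewrite Omega1_starD [cj _]/(cj (st e) + cj (st e') : conj_bimod E) HD.
- rewrite Omega1_star_lact; symmetry.
  exact: (congr1 (fun h : dual_bimod E => h w) (Hl b (cj (st e)))).
Qed.

Lemma pairing_of_otimes w e : pairing_of H (otimes w e) = H (cj (st e)) w.
Proof. exact: (balanced_lift_pure w e pairing_of_balanced). Qed.

Lemma pairing_of_is_pairing : is_pairing (pairing_of H).
Proof.
have [HD Hl Hr] := H_hom.
have pD : {morph pairing_of H : t t' / t + t'} :=
  balanced_liftD pairing_of_balanced.
have p0 : pairing_of H 0 = 0 by apply: (addrI (pairing_of H 0)); rewrite -pD !addr0.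
split=> // [b t|t b]; elim/tens_ind: t => [|t t' et et'|w e].
- by rewrite lact0r p0 lact0r.
- by rewrite lactDr !pD et et' lactDr.
- rewrite [lact b _]btens_lact_pure [LHS]pairing_of_otimes.
  rewrite [in RHS]pairing_of_otimes; exact: (dualP _).2.
- by rewrite ract0l p0 ract0l.
- by rewrite ractDl !pD et et' ractDl.
- rewrite [ract _ b]btens_ract_pure [LHS]pairing_of_otimes Omega1_star_ract.
  rewrite [in RHS]pairing_of_otimes.
  exact: (congr1 (fun h : dual_bimod E => h w) (Hr (cj (st e)) b)).
Qed.

Lemma pairing_ofK : hermitian_of (pairing_of H) = H.
Proof.
apply/funext => x; apply: dual_ext => w.
rewrite (hermitian_ofE _ _ pairing_of_is_pairing) pairing_of_otimes.
by rewrite Omega1_starK.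
Qed.

End PairingOf.

Lemma hermitian_pairing_flip H : is_hermitian_metric H ->
  flip_pairing (pairing_of H) = pairing_of H.
Proof.
move=> [Hh _ Hs]; apply: pairing_ext => [||w e].
- exact/flip_is_pairing/pairing_of_is_pairing.
- exact: pairing_of_is_pairing.
by rewrite flip_pairing_otimes !pairing_of_otimes // Omega1_starK Hs.
Qed.

Lemma Omega2B_coact_otimes w f :
  dE2 (otimes w f) = tmul (@otimes _ _ _ O : E -> E -> E2) (dE w) (dE f).
Proof. exact: (btens_coact_pure covariant_Omega1 covariant_Omega1). Qed.

Lemma Omega2B_coact_linear : linear dE2.
Proof. exact: (btens_coact_linear covariant_Omega1 covariant_Omega1). Qed.

Lemma Omega2B_coact_lact b t :
  dE2 (lact b t) = tmul (@lact _ _ E2) (acoact B b) (dE2 t).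
Proof. exact: (btens_coact_lact covariant_Omega1 covariant_Omega1). Qed.

Lemma pairing_linear p : is_pairing p -> linear p.
Proof. exact: bimod_hom_linear. Qed.

Lemma pairing_linearr p w : is_pairing p -> linear (fun f : E => p (otimes w f)).
Proof.
by move=> pP c u v; rewrite [otimes _ _]bpure_linearr (pairing_linear pP).
Qed.

Lemma pairing_linearl p f : is_pairing p -> linear (fun w : E => p (otimes w f)).
Proof.
by move=> pP c u v; rewrite [otimes _ _]bpure_linearl (pairing_linear pP).
Qed.

Definition pair_coact p (x y : (A ⊗ E)%type) : (A ⊗ B)%type :=
  tmul (fun w f : E => p (otimes w f)) x y.

Lemma colinear_pairing p : is_pairing p ->
  colinear dE2 (acoact B) p <->
  forall w f, acoact B (p (otimes w f)) = pair_coact p (dE w) (dE f).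
Proof.
move=> pP; have lp := pairing_linear pP; split=> [pc w f|pc].
  by rewrite pc Omega2B_coact_otimes tmap_tmul.
apply: btens_linear_ext => [c u v|c u v|w f].
- by rewrite lp linearP.
- by rewrite Omega2B_coact_linear tmap_linear.
- by rewrite [LHS]pc [X in tmap _ _ X]Omega2B_coact_otimes tmap_tmul.
Qed.

(** The coaction of conj f and that of f^* conjugate the A-component in the same
    way, so that both sides are f_(-1)^* ⊗ (m, f_(0)^* ). *)
Lemma conj_coactE p f m : is_pairing p ->
  tmap id (fun h : dual_bimod E => h m)
    (tmap id (hermitian_of p) (conj_coact dE (cj f))) =
  tmap id (fun y : E => p (otimes m y)) (dE (st f)).
Proof.
move=> pP; have lH := bimod_hom_linear (hermitian_of_bimod_hom pP).
rewrite Omega1_coact_star tmap_comp // [dE (uncj _)]/(dE f).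
rewrite /conj_coact (linear_map_sum (tmap_linear _ _)) //; last first.
  by move=> c u v; rewrite lH.
have -> : tmap (@star C A) st (dE f) = \sum_(q <- repr (dE f)) star q.1 ⊗ st q.2.
  by [].
rewrite (linear_map_sum (tmap_linear _ (pairing_linearr _ pP))) //.
apply: eq_bigr => q _; rewrite tmap_pure ?hermitian_ofE ?tmap_pure //.
- exact: pairing_linearr.
- by move=> c u v; rewrite lH.
Qed.

Lemma hermitian_dual_coact p f (t : (A ⊗ dual_bimod E)%type) : is_pairing p ->
  is_dual_coact dE (hermitian_of p (cj f)) t <->
  forall m, tmap id (fun h : dual_bimod E => h m) t =
     abind (antipode_coact dE m) (fun k => acoact B (p (otimes k (st f)))).
Proof.
move=> pP; split=> [/is_dual_coactE tP m|tP].
  by rewrite tP; apply: eq_abind => k; rewrite hermitian_ofE.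
apply/is_dual_coactE => m; rewrite tP.
by apply: eq_abind => k; rewrite hermitian_ofE.
Qed.

Section WithDualBasis.
Variables (n : nat) (e : 'I_n -> E) (eps : 'I_n -> left_dual E).
Hypothesis dual_basisP : forall m, m = \sum_(i < n) lact (eps i m) (e i).

(** The tensor is g = sum_i x_i ⊗ e_i, where x_i represents eps_i. The left
    identity is the dual basis property. The right one follows by
    nondegeneracy: (m, sum g1 (g2, w)) = sum (m, g1) (g2, w) = (m, w). *)
Lemma hermitian_metric_tensor H : is_hermitian_metric H ->
  exists g, is_metric g (pairing_of H).
Proof.
move=> [Hh [K HK KH] Hs]; have pP := pairing_of_is_pairing Hh.
set p := pairing_of H in pP *.
pose x i : E := st (uncj (K (eps i))).
have px w i : p (otimes w (x i)) = eps i w.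
  by rewrite /p pairing_of_otimes // Omega1_starK [H _]KH.
pose g : E2 := \sum_(i < n) otimes (x i) (e i); exists g.
have gl w : contract p w g = w.
  rewrite (additive_sum _ _ (balanced_liftD (contractl_balanced pP w))).
  rewrite [RHS]dual_basisP; apply: eq_bigr => i _.
  by rewrite (balanced_lift_pure _ _ (contractl_balanced pP w)) px.
split=> // w; apply: (can_inj Omega1_starK); apply: (can_inj HK).
apply: dual_ext => m.
rewrite -!pairing_of_otimes // -/p -[in RHS](gl m) /tlift.
rewrite (additive_sum _ _ (pairingDr pP m)) (additive_sum _ _ (pairingDl pP w)).
by apply: eq_bigr => q _; rewrite pairing_lact // pairing_ract.
Qed.

(** By colinearity of p, the right side S(m_(-1)) d(m_(0), x^* ) defining the dual
    coaction is S(m_(-2)) m_(-1) (x^* )_(-1) ⊗ (m_(0), (x^* )_(0)), in which the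
    antipode cancels. *)
Lemma covariant_pairing_hermitian p : is_pairing p ->
  colinear dE2 (acoact B) p ->
  colinear (conj_coact (@Omega1_coact _ _ _ O)) (dual_coact (@Omega1_coact _ _ _ O))
    (hermitian_of p).
Proof.
move=> pP /(colinear_pairing pP) pc x; apply: (dual_coactP (dE := dE) dual_basisP).
apply/(hermitian_dual_coact _ _ pP) => m; rewrite (conj_coactE x m pP).
pose F (w : E) := tmap id (fun y : E => p (otimes w y)) (dE (st x)).
have lF : linear F.
  move=> c u v; rewrite /F !tmap_abind; move: u v; apply: abind_linearr => y d u v.
  by rewrite (pairing_linearl _ pP) aret_linear.
rewrite -[LHS](antipode_coactK dEP m lF); apply: eq_abind => k.
by rewrite pc /pair_coact tmul_tmap.
Qed.

(** The dual coaction is 0 at a functional that has no solution of the defining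
    equation, so a solution must be exhibited before colinearity of H says
    anything. It exists: otherwise the colinear H would send the conjugate
    coaction to 0, the counit would give H(conj f^* ) = 0, and the zero functional
    has the solution 0. After that, p(w, f) is recovered from
    w_(-2) S(w_(-1)) d(w_(0), f) = d(w, f). *)
Lemma covariant_hermitian_pairing p : is_pairing p ->
  colinear (conj_coact (@Omega1_coact _ _ _ O)) (dual_coact (@Omega1_coact _ _ _ O))
    (hermitian_of p) ->
  colinear dE2 (acoact B) p.
Proof.
move=> pP Hc; apply/(colinear_pairing pP) => w f.
have [s sP] : exists s, is_dual_coact dE (hermitian_of p (cj (st f))) s.
  apply: contrapT => noT.
  have t0 : tmap id (hermitian_of p) (conj_coact dE (cj (st f))) = 0.
    by rewrite -[LHS]Hc; apply: xgetPN => s sP; apply: noT; exists s.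
  have Hf0 m : p (otimes m f) = 0.
    have := conj_coactE (st f) m pP; rewrite t0 Omega1_starK.
    rewrite (linear_map0 (tmap_linear _ _)) // => /esym p0.
    have := counit_map_tmap (dE f) (pairing_linearr m pP).
    rewrite p0 [counit_map (dE f)]dEP.2 => <-.
    exact: linear_map0 (@counit_map_linear _ _ _).
  apply: noT; exists 0; apply/(hermitian_dual_coact _ _ pP) => m.
  rewrite (linear_map0 (tmap_linear _ _)) //.
  rewrite abindE big1 // => q _; rewrite Omega1_starK Hf0 linear0.
  exact: linear_map0 (@amul_linear _ _ _ _).
have {}tP : is_dual_coact dE (hermitian_of p (cj (st f)))
    (tmap id (hermitian_of p) (conj_coact dE (cj (st f)))).
  by rewrite -[tmap _ _ _]Hc (dual_coactP dual_basisP sP).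
move/(hermitian_dual_coact _ _ pP): tP; rewrite Omega1_starK => tP.
have lF : linear (fun k => acoact B (p (otimes k f))).
  by move=> c u v; rewrite (pairing_linearl _ pP) linearP.
rewrite -[LHS](coact_antipodeK dEP w lF) /pair_coact tmul_tmap.
by apply: eq_abind => k; rewrite -tP conj_coactE // Omega1_starK.
Qed.

End WithDualBasis.

Lemma contractl_linear p w : is_pairing p ->
  linear (fun t : E2 => contract p w t).
Proof.
move=> pP; apply: btlift_linear => [y c u v|x c u v|x b y].
- by rewrite (pairing_linearr _ pP) lactl.
- exact: lactr.
- by rewrite pairing_ract // lactM.
Qed.

(** On t = x ⊗ y both sides are the product of d(w), d(x) and d(y), formed
    along (w, x) y. *)
Lemma contractl_colinear p w t : is_pairing p ->
  colinear dE2 (acoact B) p ->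
  dE (contract p w t) =
  tmul (fun w' (t' : E2) => contract p w' t') (dE w) (dE2 t).
Proof.
move=> pP /(colinear_pairing pP) pc; have lc v := contractl_linear v pP.
move: t; apply: btens_linear_ext => [c u v|c u v|x y].
- by rewrite (lc w) linearP.
- rewrite Omega2B_coact_linear tmul_linearr //.
rewrite (balanced_lift_pure _ _ (contractl_balanced pP w)).
rewrite (cov_lact covariant_Omega1) pc [dE2 _]Omega2B_coact_otimes.
apply: tmulA => // [m|m k l]; first exact: lact_linearl.
by rewrite (balanced_lift_pure _ _ (contractl_balanced pP m)).
Qed.

(** x ⊗ y = sum g1 (g2, x) ⊗ y = sum g1 ⊗ (g2, x) y: a tensor is recovered from
    its contractions with finitely many forms. *)
Lemma metric_expand g p t : is_metric g p ->
  t = \sum_(q <- repr g) otimes q.1 (contract p q.2 t).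
Proof.
move=> [pP _ pr]; move: t.
apply: btens_linear_ext => [//|c u v|x y].
  rewrite scaler_sumr -big_split; apply: eq_bigr => q _.
  by rewrite (contractl_linear _ pP) [otimes _ _]bpure_linearr.
rewrite -{1}[x]pr -[LHS]/(otimes _ _) (additive_sum _ _ (otimesDl _)).
apply: eq_bigr => q _.
by rewrite (balanced_lift_pure _ _ (contractl_balanced pP _)) otimes_bal.
Qed.

(** Write F(w) for the contraction of w with the first leg of d(g) in Omega^1.
    Colinearity turns (w, g1) g2 = w into w_(-1) F(w_(0)) = d(w), and cancelling
    w_(-1) gives F(w) = 1 ⊗ w, as if d(g) were 1 ⊗ g. By [metric_expand] the
    contractions determine d(g). *)
Lemma metric_coinvariant g p : is_metric g p ->
  colinear dE2 (acoact B) p -> dE2 g = aret A g.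
Proof.
move=> gp pc; have [pP pl _] := gp; have lc v := contractl_linear v pP.
have contract_coact w :
    tmap id (fun t : E2 => contract p w t) (dE2 g) = aret A w.
  pose F (v : E) := tmap id (fun t : E2 => contract p v t) (dE2 g).
  have lF : linear F.
    move=> c u v; rewrite /F !tmap_abind; move: u v.
    apply: abind_linearr => t d u v.
    rewrite -[RHS]aret_linear; congr aret; rewrite /tlift scaler_sumr -big_split.
    by apply: eq_bigr => q _; rewrite (pairing_linearl _ pP) lactl.
  rewrite -[LHS](antipode_coactK dEP w lF).
  rewrite -(antipode_coactK dEP w (@aret_linear _ _ _)).
  apply: eq_abind => v; rewrite abind_retr -[in RHS](pl v).
  by rewrite (contractl_colinear _ _ pP pc) tmul_tmap.
rewrite -[LHS]tmap_id (eq_tmap _ (fun t => @metric_expand g p t gp)) tmap_sum.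
rewrite [in RHS](tens_sum g) (linear_map_sum (@aret_linear _ _ _)).
apply: eq_bigr => q _.
rewrite -(tmap_comp (f := fun y : E => otimes q.1 y)) ?contract_coact; last first.
  exact: bpure_linearr.
by rewrite tmap_pure //; exact: bpure_linearr.
Qed.

Lemma covariant_metric_of_pairing g p : is_metric g p ->
  colinear dE2 (acoact B) p -> covariant_metric g p.
Proof.
move=> gp pc; split=> // b.
rewrite Omega2B_coact_lact (metric_coinvariant gp pc) tmul_retr // => c.
exact: lact_linearr.
Qed.

Lemma hermitian_of_bij : left_fin_gen E -> left_projective E ->
  set_bij (real_covariant_metrics O) (covariant_hermitian_metrics O)
    (fun gp => hermitian_of gp.2).
Proof.
move=> Efg Eproj; have [n [e [eps basisP]]] := dual_basis Efg Eproj; split.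
- move=> [g p] /= [gp [pc _] gg]; split; first exact: hermitian_of_metric gp gg.
  by have [pP _ _] := gp; exact: (covariant_pairing_hermitian basisP).
- move=> [g p] [g' p'] /set_mem[/= gp _ _] /set_mem[/= g'p' _ _] Hpp'.
  have [[pP _ _] [p'P _ _]] := (gp, g'p').
  have pp' : p = p'.
    apply: pairing_ext => // w f; rewrite -[f]Omega1_starK.
    by rewrite -!hermitian_ofE // Hpp'.
  by move: g'p'; rewrite -pp' => g'p; rewrite (metric_tensor_unique gp g'p).
- move=> H [HH Hc]; have [Hh _ _] := HH.
  have [g gp] := hermitian_metric_tensor basisP HH.
  have pP := pairing_of_is_pairing Hh.
  have pK := pairing_ofK Hh.
  exists (g, pairing_of H) => //; split => //=.
    apply: covariant_metric_of_pairing gp _.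
    by apply: (covariant_hermitian_pairing basisP) => //; rewrite pK.
  exact/(metric_real gp)/hermitian_pairing_flip.
Qed.

End Metrics.

Local Open Scope complex_scope.

Theorem proposition4p3 (R : realType) (A : hopfStarAlgebra R[i])
    (B : comoduleStarAlgebra A) (O : covStarCalculus B)
    (Ofg : left_fin_gen (Omega1 O)) (Oproj : left_projective (Omega1 O)) :
  exists Phi : Omega2B O * (Omega2B O -> B) ->
               conj_bimod (Omega1 O) -> dual_bimod (Omega1 O),
    set_bij (real_covariant_metrics O) (covariant_hermitian_metrics O) Phi /\
    (forall (g : Omega2B O) (p : Omega2B O -> B),
       real_covariant_metrics O (g, p) ->
       forall w e : Omega1 O,
         Phi (g, p) (cj e) w = p (otimes w (Omega1_star e))).
Proof.
exists (fun gp => hermitian_of gp.2); split; first exact: hermitian_of_bij.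
by move=> g p [[pP _ _] _ _] w e; exact: hermitian_ofE.
Qed.
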